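(* Let $M$ be a smooth manifold and let $\varphi$ be a minimal non-resonant generalized polynomial structure on $M$. Then the semisimple part $\varphi_s$ of $\varphi$ is a weak generalized Nijenhuis operator.
   Context: $\mathbb{T}M=TM\oplus T^*M$ carries the inner product $\langle X+\alpha,Y+\beta\rangle=\frac12(\alpha(Y)+\beta(X))$. A generalized polynomial structure is a $C^\infty$-linear endomorphism $\varphi$ of $\mathbb{T}M$, skew-symmetric for $\langle\cdot,\cdot\rangle$, for which there is a monic $P(x)\in\mathbb{R}[x]$ of positive degree (the minimal polynomial of $\varphi$) that is the minimal polynomial of $\varphi_p$ on $\mathbb{T}_pM$ for every $p\in M$. $\Sigma(\varphi)\subset\mathbb{C}$ is the set of eigenvalues of $\varphi$. The semisimple part $\varphi_s$ is, fiberwise, the semisimple part in the Jordan–Chevalley decomposition of $\varphi$. $\varphi$ is non-resonant if $P(\lambda+\mu+\nu)\ne0$ for any $\lambda,\mu,\nu\in\Sigma(\varphi)$ such that $(\lambda+\mu)(\lambda+\nu)(\mu+\nu)\neq0$. Let $\Omega_M$ be the sheaf of differential forms, $\mathcal{E}_M$ the sheaf of $\mathbb{R}$-linear endomorphisms of $\Omega_M$ with its natural grading and graded commutator $[\psi,\chi]=\psi\chi-(-1)^{kl}\chi\psi$ for $\psi,\chi$ of degrees $k,l$, and $\mathrm{ad}_\psi(\chi)=[\psi,\chi]$. Vector fields act on $\Omega_M$ by contraction and forms by left wedge multiplication, so sections of $\mathbb{T}M$ and of $\Omega_M$ are regarded as sections of $\mathcal{E}_M$. For a skew-symmetric endomorphism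 $\varphi$ of $\mathbb{T}M$, $\widetilde\varphi\in\mathcal{E}_M$ is the unique even operator with $[\widetilde\varphi,f]=0$ for all functions $f$, $[\widetilde\varphi,\mathbf{x}]=\varphi(\mathbf{x})$ for all $\mathbf{x}\in\mathbb{T}M$, and $\widetilde\varphi(1)\in\Omega^2_M$. The minimal operator is $\delta_\varphi=P(\mathrm{ad}_{\widetilde\varphi})(d)$, the minimal torsion is $\mathcal{M}_\varphi(\mathbf{x},\mathbf{y})=[[\mathbf{x},\delta_\varphi],\mathbf{y}]$ for $\mathbf{x},\mathbf{y}\in\mathbb{T}M$, and $\varphi$ is minimal if $\mathcal{M}_\varphi=0$. The Dorfman bracket is $[\![\mathbf{x},\mathbf{y}]\!]=[[\mathbf{x},d],\mathbf{y}]$, i.e. $[\![X+\alpha,Y+\beta]\!]=[X,Y]+\mathcal{L}_X\beta-\iota_Yd\alpha$. For an endomorphism $\psi$ of $\mathbb{T}M$ let $\mathcal{T}_\psi(\mathbf{x},\mathbf{y})=\psi^2[\![\mathbf{x},\mathbf{y}]\!]+[\![\psi(\mathbf{x}),\psi(\mathbf{y})]\!]-\psi([\![\psi(\mathbf{x}),\mathbf{y}]\!]+[\![\mathbf{x},\psi(\mathbf{y})]\!])$ and $\mathcal{S}_\psi(\mathbf{x},\mathbf{y})=\mathcal{T}_\psi(\psi(\mathbf{x}),\mathbf{y})+\mathcal{T}_\psi(\mathbf{x},\psi(\mathbf{y}))$. $\psi$ is a weak generalized Nijenhuis operator if $\mathcal{S}_\psi=0$. *)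

(* Defs.v *)
(* [R : realType] is the field of real numbers. *)
From HB Require Import structures.
From mathcomp Require Import all_boot all_order all_algebra generic_quotient ring_quotient.
From mathcomp Require Import all_classical all_reals.
From mathcomp Require Import topology normedtype derive.
From mathcomp Require Import complex.
From mathcomp Require Import ring lra.

Set Implicit Arguments.
Unset Strict Implicit.
Unset Printing Implicit Defensive.

Import Order.TTheory GRing.Theory Num.Theory.
Import numFieldNormedType.Exports.
Import Quotient.Exports.

Local Open Scope classical_set_scope.
Local Open Scope ring_scope.

Section SmoothOn.
Context (R : realType) (n : nat).
Implicit Types (U : set 'rV[R]_n) (f g : 'rV[R]_n -> R).

Fixpoint Ck_on (k : nat) U f : Prop :=
  (forall x, U x -> {for x, continuous f}) /\
  if k is k'.+1 then
    forall i : 'I_n, (forall x, U x -> derivable f x (delta_mx 0 i)) /\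
                     Ck_on k' U ('D_(delta_mx 0 i) f)
  else True.

Definition smooth_on U f := forall k, Ck_on k U f.

Lemma near_open U (P : 'rV[R]_n -> Prop) x : open U ->
  (forall y, U y -> P y) -> U x -> \forall y \near x, P y.
Proof.
by move=> oU UP Ux; apply: filterS (UP) _; apply: open_nbhs_nbhs; split.
Qed.

Lemma Ck_on_ext k U f g : open U -> (forall x, U x -> f x = g x) ->
  Ck_on k U f -> Ck_on k U g.
Proof.
move=> oU; elim: k f g => [|k IH] f g fg [cf df].
all: have nfg x (Ux : U x) : \forall y \near x, f y = g y
  by apply: (near_open oU _ Ux).
all: have cg x : U x -> {for x, continuous g}.
1,3: move=> Ux; have /near_eq_cvg H := nfg x Ux.
1,2: rewrite /prop_for /continuous_at -fg //.
1,2: exact: cvg_trans H (cf x Ux).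
- by split.
split=> // i; have [dfi Dfi] := df i; split.
  by move=> x Ux; apply: near_eq_derivable (dfi x Ux); exact: nfg.
by apply: IH Dfi => x Ux; apply: near_eq_derive; exact: nfg.
Qed.

Lemma Ck_onW k U f : Ck_on k.+1 U f -> Ck_on k U f.
Proof.
elim: k f => [|k IH] f [cf df]; first by split.
by split=> // i; have [dfi Dfi] := df i; split=> //; exact: IH.
Qed.

Lemma Ck_on_cst k U (c : R) : Ck_on k U (fun=> c).
Proof.
elim: k c => [|k IH] c.
  by split=> // x _; exact: cst_continuous.
split=> [x _|i]; first exact: cst_continuous.
split=> [x _|]; first exact: derivable_cst.
rewrite [X in Ck_on _ _ X](_ : _ = fun=> 0) //.
by apply/funext => x; exact: (derive_cst c).
Qed.

Lemma Ck_onB k U f g : open U ->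
  Ck_on k U f -> Ck_on k U g -> Ck_on k U (f - g).
Proof.
move=> oU; elim: k f g => [|k IH] f g [cf df] [cg dg].
  by split=> // x Ux; exact: (cvgB (cf x Ux) (cg x Ux)).
split=> [x Ux|i]; first exact: (cvgB (cf x Ux) (cg x Ux)).
have [dfi Dfi] := df i; have [dgi Dgi] := dg i; split=> [x Ux|].
  by apply: derivableB; [exact: dfi|exact: dgi].
apply: Ck_on_ext (IH _ _ Dfi Dgi) => // x Ux.
by rewrite deriveB //; [exact: dfi|exact: dgi].
Qed.

Lemma Ck_onD k U f g : open U ->
  Ck_on k U f -> Ck_on k U g -> Ck_on k U (f + g).
Proof.
move=> oU Cf Cg; rewrite -[g]opprK; apply: Ck_onB => //.
by rewrite -[- g]add0r; apply: Ck_onB => //; exact: Ck_on_cst.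
Qed.

Lemma Ck_onM k U f g : open U ->
  Ck_on k U f -> Ck_on k U g -> Ck_on k U (f * g).
Proof.
move=> oU; elim: k f g => [|k IH] f g Cf Cg; move: (Cf) (Cg) => [cf df] [cg dg].
  by split=> // x Ux; exact: (cvgM (cf x Ux) (cg x Ux)).
split=> [x Ux|i]; first exact: (cvgM (cf x Ux) (cg x Ux)).
have [dfi Dfi] := df i; have [dgi Dgi] := dg i; split=> [x Ux|].
  by apply: derivableM; [exact: dfi|exact: dgi].
apply: Ck_on_ext (Ck_onD oU (IH _ _ (Ck_onW Cf) Dgi) (IH _ _ (Ck_onW Cg) Dfi)).
  by [].
by move=> x Ux; rewrite deriveM //; [exact: dfi|exact: dgi].
Qed.

End SmoothOn.

Record chart (R : realType) (n : nat) (T : topologicalType) := Chart {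
  chart_dom : set T;
  chart_map : T -> 'rV[R]_n;
  chart_inv : 'rV[R]_n -> T;
  chart_dom_open : open chart_dom;
  chart_cod_open : open (chart_map @` chart_dom);
  chart_mapK : {in chart_dom, cancel chart_map chart_inv};
  chart_map_continuous :
    forall x, chart_dom x -> {for x, continuous chart_map};
  chart_inv_continuous :
    forall u, (chart_map @` chart_dom) u -> {for u, continuous chart_inv} }.

(* A smooth manifold of dimension [n]; the smooth structure is the one
   generated by [atlas], which is not required to be maximal. *)
Record smoothManifold (R : realType) (n : nat) := SmoothManifold {
  carrier :> topologicalType;
  carrier_hausdorff : hausdorff_space carrier;
  carrier_second_countable : @second_countable carrier;
  atlas : set (chart R n carrier);
  atlas_cover : forall x, exists2 c, atlas c & chart_dom c x;
  atlas_compatible : forall c d, atlas c -> atlas d -> forall i : 'I_n,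
    smooth_on (chart_map c @` (chart_dom c `&` chart_dom d))
              (fun u => chart_map d (chart_inv c u) 0 i) }.

Section SmoothFunctions.
Context (R : realType) (n : nat) (M : smoothManifold R n).

Definition smooth (f : M -> R) := forall c, atlas c ->
  smooth_on (chart_map c @` chart_dom c) (f \o chart_inv c).

Definition smooth_pred : {pred M -> R} := fun f => `[< smooth f >].

Lemma smooth_subring_closed : subring_closed smooth_pred.
Proof.
split=> [|f g /asboolP sf /asboolP sg|f g /asboolP sf /asboolP sg];
  apply/asboolP => c Ac k.
- exact: Ck_on_cst.
- exact: (@Ck_onB _ _ k _ (f \o _) (g \o _)
    (@chart_cod_open _ _ _ c) (sf c Ac k) (sg c Ac k)).
- exact: (@Ck_onM _ _ k _ (f \o _) (g \o _)
    (@chart_cod_open _ _ _ c) (sf c Ac k) (sg c Ac k)).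
Qed.

Record smooth_fun := SmoothFun {
  smooth_val :> M -> R;
  smooth_valP : smooth_val \in smooth_pred }.

HB.instance Definition _ := [isSub for smooth_val].
HB.instance Definition _ := [Choice of smooth_fun by <:].
HB.instance Definition _ :=
  GRing.SubChoice_isSubComPzRing.Build (M -> R) smooth_pred smooth_fun
    smooth_subring_closed.

Lemma smooth_cst (c : R) : (fun=> c) \in smooth_pred.
Proof. by apply/asboolP => d _ k; exact: Ck_on_cst. Qed.

Definition const_fun (c : R) : smooth_fun := SmoothFun (smooth_cst c).

End SmoothFunctions.

Section VectorFields.
Context (R : realType) (n : nat) (M : smoothManifold R n).
Local Notation A := (smooth_fun M).

(* Vector fields are the R-linear derivations of the algebra of smooth
   functions. *)
Definition derivation (D : A -> A) :=
  (forall (c : R) (f g : A),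
     D (const_fun M c * f + g) = const_fun M c * D f + D g) /\
  (forall f g : A, D (f * g) = D f * g + f * D g).

Record vfield := VField {
  vfield_fun :> A -> A;
  vfield_derivation : derivation vfield_fun }.

HB.instance Definition _ := gen_eqMixin vfield.
HB.instance Definition _ := gen_choiceMixin vfield.

Lemma vfieldP (X Y : vfield) : (forall f, X f = Y f) -> X = Y.
Proof.
case: X Y => [X dX] [Y dY] /= /funext XY; subst Y.
by congr VField; exact: Prop_irrelevance.
Qed.

Lemma vfield_lin (X : vfield) c f g :
  X (const_fun M c * f + g) = const_fun M c * X f + X g.
Proof. by case: X => X []. Qed.

Lemma vfield_leibniz (X : vfield) f g : X (f * g) = X f * g + f * X g.
Proof. by case: X => X []. Qed.

Lemma const_fun1 : const_fun M 1 = 1.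
Proof. exact: val_inj. Qed.

Lemma const_funM a b : const_fun M (a * b) = const_fun M a * const_fun M b.
Proof. exact: val_inj. Qed.

Lemma const_funD a b : const_fun M (a + b) = const_fun M a + const_fun M b.
Proof. exact: val_inj. Qed.

Lemma vfieldD (X : vfield) f g : X (f + g) = X f + X g.
Proof. by have := vfield_lin X 1 f g; rewrite const_fun1 !mul1r. Qed.

Lemma vfield0 (X : vfield) : X 0 = 0.
Proof. by apply: (addIr (X 0)); rewrite -vfieldD !add0r. Qed.

Lemma vfieldN (X : vfield) f : X (- f) = - X f.
Proof. by apply: (addIr (X f)); rewrite -vfieldD !addNr vfield0. Qed.

Lemma vfieldB (X : vfield) f g : X (f - g) = X f - X g.
Proof. by rewrite vfieldD vfieldN. Qed.

Lemma vfield_sign (X : vfield) (k : nat) f :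
  X ((-1) ^+ k * f) = (-1) ^+ k * X f.
Proof.
elim: k f => [|k IH] f; first by rewrite !expr0 !mul1r.
by rewrite !exprS !mulN1r !mulNr vfieldN IH.
Qed.

Lemma vfield_sum (X : vfield) I (r : seq I) (F : I -> A) :
  X (\sum_(i <- r) F i) = \sum_(i <- r) X (F i).
Proof. by elim/big_rec2: _ => [|i y z _ <-]; rewrite ?vfield0 ?vfieldD. Qed.

Lemma vfield_const (X : vfield) c : X (const_fun M c) = 0.
Proof.
have X1 : X 1 = 0.
  by apply: (addIr (X 1)); rewrite add0r -[in RHS](mulr1 1) vfield_leibniz mulr1 mul1r.
by have := vfield_lin X c 1 0; rewrite mulr1 !addr0 X1 vfield0 mulr0 addr0.
Qed.

Fact vfield_zero_subproof : derivation (fun=> 0).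
Proof. by split=> *; ring. Qed.
Definition vfield_zero := VField vfield_zero_subproof.

Fact vfield_opp_subproof (X : vfield) : derivation (fun f => - X f).
Proof. by split=> *; rewrite ?vfield_lin ?vfield_leibniz; ring. Qed.
Definition vfield_opp X := VField (vfield_opp_subproof X).

Fact vfield_add_subproof (X Y : vfield) : derivation (fun f => X f + Y f).
Proof. by split=> *; rewrite ?vfield_lin ?vfield_leibniz; ring. Qed.
Definition vfield_add X Y := VField (vfield_add_subproof X Y).

Fact vfield_scale_subproof (h : A) (X : vfield) :
  derivation (fun f => h * X f).
Proof. by split=> *; rewrite ?vfield_lin ?vfield_leibniz; ring. Qed.
Definition vfield_scale h X := VField (vfield_scale_subproof h X).

Fact vfield_addA : associative vfield_add.
Proof. by move=> X Y Z; apply: vfieldP => f /=; rewrite addrA. Qed.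
Fact vfield_addC : commutative vfield_add.
Proof. by move=> X Y; apply: vfieldP => f /=; rewrite addrC. Qed.
Fact vfield_add0 : left_id vfield_zero vfield_add.
Proof. by move=> X; apply: vfieldP => f /=; rewrite add0r. Qed.
Fact vfield_addN : left_inverse vfield_zero vfield_opp vfield_add.
Proof. by move=> X; apply: vfieldP => f /=; rewrite addNr. Qed.
HB.instance Definition _ := GRing.isZmodule.Build vfield
  vfield_addA vfield_addC vfield_add0 vfield_addN.

Fact vfield_scaleA a b X :
  vfield_scale a (vfield_scale b X) = vfield_scale (a * b) X.
Proof. by apply: vfieldP => f /=; rewrite mulrA. Qed.
Fact vfield_scale1 : left_id 1 vfield_scale.
Proof. by move=> X; apply: vfieldP => f /=; rewrite mul1r. Qed.
Fact vfield_scaleDr : right_distributive vfield_scale +%R.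
Proof. by move=> a X Y; apply: vfieldP => f /=; rewrite mulrDr. Qed.
Fact vfield_scaleDl X : {morph vfield_scale^~ X : a b / a + b}.
Proof. by move=> a b; apply: vfieldP => f /=; rewrite mulrDl. Qed.
HB.instance Definition _ := GRing.Zmodule_isLmodule.Build A vfield
  vfield_scaleA vfield_scale1 vfield_scaleDr vfield_scaleDl.

Lemma vfieldDE (X Y : vfield) f : (X + Y) f = X f + Y f. Proof. by []. Qed.
Lemma vfieldZE a (X : vfield) f : (a *: X) f = a * X f. Proof. by []. Qed.

Fact bracket_subproof (X Y : vfield) :
  derivation (fun f => X (Y f) - Y (X f)).
Proof.
split=> *; first by rewrite !vfield_lin; ring.
by rewrite !(vfield_leibniz, vfieldD); ring.
Qed.
Definition bracket X Y := VField (bracket_subproof X Y).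

Lemma bracketxx X : bracket X X = 0.
Proof. by apply: vfieldP => f /=; rewrite subrr. Qed.

Lemma bracket_linr Z c X Y :
  bracket Z (c *: X + Y) = c *: bracket Z X + (Z c *: X + bracket Z Y).
Proof.
apply: vfieldP => f /=; rewrite ?(vfieldDE, vfieldZE) /=.
by rewrite ?(vfieldDE, vfieldZE) ?(vfieldD, vfield_leibniz); ring.
Qed.

Lemma bracket_linl Z c X Y :
  bracket (c *: X + Y) Z = c *: bracket X Z + (- Z c *: X + bracket Y Z).
Proof.
apply: vfieldP => f /=; rewrite ?(vfieldDE, vfieldZE) /=.
by rewrite ?(vfieldDE, vfieldZE) ?(vfieldD, vfield_leibniz); ring.
Qed.

End VectorFields.

Section Forms.
Context (R : realType) (n : nat) (M : smoothManifold R n).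
Local Notation A := (smooth_fun M).
Local Notation V := (vfield M).
Implicit Types (w : seq V -> A) (X Y Z : V) (s t u : seq V).

(* An element of Omega(M) is encoded as one function [w] on finite sequences
   of vector fields: its component of degree k is the restriction of [w] to
   sequences of length k, an alternating k-linear map over the ring of smooth
   functions.  There is no need to ask that only finitely many components be
   nonzero: those of degree greater than [n] vanish. *)
Definition multilinear w := forall s t (h : A) X Y,
  w (s ++ (h *: X + Y) :: t) = h * w (s ++ X :: t) + w (s ++ Y :: t).

Definition alternating w := forall s, ~~ uniq s -> w s = 0.

Record diff_form := Form {
  form_fun :> seq V -> A;
  form_multilinear : multilinear form_fun;
  form_alternating : alternating form_fun }.

HB.instance Definition _ := gen_eqMixin diff_form.
HB.instance Definition _ := gen_choiceMixin diff_form.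

Lemma formP (w z : diff_form) : (forall s, w s = z s) -> w = z.
Proof.
case: w z => [w lw aw] [z lz az] /= /funext wz; subst z.
by congr Form; exact: Prop_irrelevance.
Qed.

Definition delete (i : nat) s := take i s ++ drop i.+1 s.

Definition contract_raw X w s := w (X :: s).

Definition wedge_raw (a : V -> A) w s :=
  \sum_(i < size s) (-1) ^+ i * (a s`_i * w (delete i s)).

(* Koszul's formula, without normalizing factor:
   (d a)(X, Y) = X (a Y) - Y (a X) - a [X, Y]. *)
Definition ext_d_raw w s :=
  \sum_(i < size s) (-1) ^+ i * (s`_i) (w (delete i s)) +
  \sum_(j < size s) \sum_(i < j)
    (-1) ^+ (i + j) * w (bracket s`_i s`_j :: delete i (delete j s)).

Definition lie_raw w X s :=
  X (w s) - \sum_(i < size s) w (set_nth 0 s i (bracket X s`_i)).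

Definition is_form w := multilinear w /\ alternating w.

Lemma form_lin1 w X Y h t : multilinear w ->
  w (h *: X + Y :: t) = h * w (X :: t) + w (Y :: t).
Proof. by move=> lw; exact: (lw [::]). Qed.

Definition adjacent_zero w := forall s X t, w (s ++ X :: X :: t) = 0.

Lemma form_lin0 w s t : multilinear w -> w (s ++ 0 :: t) = 0.
Proof.
move=> lw; have := lw s t 1 0 0; rewrite scaler0 addr0 mul1r => e.
by apply: (addIr (w (s ++ 0 :: t))); rewrite -e add0r.
Qed.

Lemma form_linD w s t X Y : multilinear w ->
  w (s ++ (X + Y) :: t) = w (s ++ X :: t) + w (s ++ Y :: t).
Proof. by move=> lw; have := lw s t 1 X Y; rewrite scale1r mul1r. Qed.

Lemma form_swap w : multilinear w -> adjacent_zero w -> forall s X Y t,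
  w (s ++ X :: Y :: t) = - w (s ++ Y :: X :: t).
Proof.
move=> lw aw s X Y t; have := aw s (X + Y) t.
rewrite form_linD // -[in X in X + _]cat_rcons -[in X in _ + X]cat_rcons.
rewrite !form_linD // !cat_rcons !aw add0r addr0.
by move/eqP; rewrite addr_eq0 => /eqP.
Qed.

Lemma alternatingP w : multilinear w -> adjacent_zero w -> is_form w.
Proof.
move=> lw aw; split=> // s.
have H X t1 t2 u : w (u ++ X :: t1 ++ X :: t2) = 0.
  elim: t1 u => [|Y t1 IH] u; first exact: aw.
  by rewrite /= form_swap // -cat_rcons IH oppr0.
suff K u : ~~ uniq s -> w (u ++ s) = 0 by exact: (K [::]).
elim: s u => [//|X s IH] u /=; rewrite negb_and negbK => /orP[|ns].
  by case/splitPr => t1 t2; exact: H.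
by rewrite -cat_rcons; exact: IH.
Qed.

Lemma isform_adj w : is_form w -> adjacent_zero w.
Proof.
by move=> [_ aw] s X t; apply: aw; rewrite cat_uniq /= inE eqxx !andbF.
Qed.

Lemma contractK w X : adjacent_zero w -> contract_raw X (contract_raw X w) = fun=> 0.
Proof. by move=> aw; apply/funext => s; exact: (aw [::]). Qed.

Lemma isform_contract X w : is_form w -> is_form (contract_raw X w).
Proof.
move=> [lw aw]; split=> [s t h Y Z|s us].
  exact: (lw (X :: s)).
by apply: aw; rewrite /= (negbTE us) andbF.
Qed.

Lemma form_swap1 w X Y t : is_form w -> w (X :: Y :: t) = - w (Y :: X :: t).
Proof.
by move=> fw; exact: (form_swap fw.1 (isform_adj fw) [::]).
Qed.

Lemma isform_linear w z h : is_form w -> is_form z ->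
  is_form (fun s => h * w s + z s).
Proof.
move=> [lw aw] [lz az]; split=> [s t k X Y|s us].
  by rewrite lw lz; ring.
by rewrite aw ?az // mulr0 addr0.
Qed.

Lemma isform0 : is_form (fun=> 0).
Proof. by split=> // s t h X Y; rewrite mulr0 addr0. Qed.

Lemma form_move_front w Y i t : is_form w -> (i < size t)%N ->
  w (Y :: delete i t) = (-1) ^+ i * w (set_nth 0 t i Y).
Proof.
elim: t w i => [//|Z t IH] w [|i] fw.
  by move=> _; rewrite /delete take0 drop1 expr0 mul1r.
move=> lit; rewrite /delete /= form_swap1 // -/(delete i t).
have := IH _ i (isform_contract Z fw) lit; rewrite /contract_raw => ->.
by rewrite exprS mulN1r mulNr.
Qed.

Lemma wedge_nil a w : wedge_raw a w [::] = 0.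
Proof. by rewrite /wedge_raw big_ord0. Qed.

Lemma wedge_cons a w X t :
  wedge_raw a w (X :: t) = a X * w t - wedge_raw a (contract_raw X w) t.
Proof.
rewrite /wedge_raw /= big_ord_recl expr0 mul1r /= /delete take0 drop1 /=.
congr (_ + _); rewrite -sumrN; apply: eq_bigr => i _.
by rewrite /= exprS mulN1r mulNr.
Qed.

Lemma wedge_lin a w z h t :
  wedge_raw a (fun s => h * w s + z s) t =
  h * wedge_raw a w t + wedge_raw a z t.
Proof.
rewrite /wedge_raw mulr_sumr -big_split /=; apply: eq_bigr => i _; ring.
Qed.

Lemma wedge0 a t : wedge_raw a (fun=> 0) t = 0.
Proof. by rewrite /wedge_raw big1 // => i _; rewrite !mulr0. Qed.

Lemma contract_lin w h X Y : multilinear w ->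
  contract_raw (h *: X + Y) w =
  fun s => h * contract_raw X w s + contract_raw Y w s.
Proof. by move=> lw; apply/funext => s; rewrite /contract_raw form_lin1. Qed.

Lemma wedge_subproof (a : V -> A) (w : diff_form) :
  (forall h X Y, a (h *: X + Y) = h * a X + a Y) ->
  multilinear (wedge_raw a w) /\ alternating (wedge_raw a w).
Proof.
move=> la; case: w => w lw aw /=; have {lw aw} fw : is_form w by [].
apply: alternatingP.
  move=> s; elim: s w fw => [|Z s IH] w fw t h X Y /=.
    by rewrite !wedge_cons la contract_lin ?wedge_lin; [ring | case: fw].
  rewrite !wedge_cons fw.1 IH; first by ring.
  exact: isform_contract.
move=> s; elim: s w fw => [|Z s IH] w fw X t /=.
  rewrite !wedge_cons contractK ?wedge0; last exact: isform_adj.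
  by rewrite /contract_raw; ring.
rewrite wedge_cons IH ?isform_adj //; last exact: isform_contract.
by rewrite mulr0 subr0.
Qed.

Lemma lie_cons w Z Y t :
  lie_raw w Z (Y :: t) = lie_raw (contract_raw Y w) Z t - w (bracket Z Y :: t).
Proof.
rewrite /lie_raw /= big_ord_recl /= opprD addrA addrAC; congr (_ - _ - _).
Qed.

Lemma lie_lin w z Z h t :
  lie_raw (fun s => h * w s + z s) Z t =
  Z h * w t + h * lie_raw w Z t + lie_raw z Z t.
Proof.
rewrite /lie_raw vfieldD vfield_leibniz big_split /= -mulr_sumr; ring.
Qed.

Lemma lie0 Z t : lie_raw (fun=> 0) Z t = 0.
Proof. by rewrite /lie_raw vfield0 big1 // subr0. Qed.

Lemma lie_multilinear w Z : is_form w -> multilinear (lie_raw w Z).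
Proof.
move=> fw s; elim: s w fw => [|U s IH] w fw t h X Y /=.
  rewrite !lie_cons contract_lin; last exact: fw.1.
  by rewrite lie_lin bracket_linr !form_lin1 /contract_raw; [ring|exact: fw.1..].
rewrite !lie_cons IH; last exact: isform_contract.
by rewrite (fw.1 (bracket Z U :: s)) /=; ring.
Qed.

Lemma lie_adjacent w Z : is_form w -> adjacent_zero (lie_raw w Z).
Proof.
move=> fw s; elim: s w fw => [|U s IH] w fw X t /=.
  rewrite !lie_cons contractK ?lie0; last exact: isform_adj.
  by rewrite /contract_raw form_swap1 //; ring.
rewrite !lie_cons IH; last exact: isform_contract.
by rewrite (isform_adj fw (bracket Z U :: s)) subr0.
Qed.

Lemma ext_d_nil w : ext_d_raw w [::] = 0.
Proof. by rewrite /ext_d_raw !big_ord0 addr0. Qed.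

Lemma ext_d_cons w X t : is_form w ->
  ext_d_raw w (X :: t) = lie_raw w X t - ext_d_raw (contract_raw X w) t.
Proof.
move=> fw; rewrite /ext_d_raw /lie_raw /= !big_ord_recl /= big_ord0 add0r.
rewrite expr0 mul1r {1}/delete take0 drop1 -!addrA; congr (_ + _).
under [X in _ + X = _]eq_bigr do rewrite big_ord_recl /=.
rewrite big_split /= opprD addrCA; congr (_ + _).
  rewrite -sumrN; apply: eq_bigr => i _.
  rewrite !add0n {1}/delete take0 drop1 /= (form_move_front _ fw (ltn_ord i)).
  by rewrite mulrA exprS mulN1r mulNr -expr2 sqrr_sign mulN1r.
congr (_ + _); rewrite -sumrN; apply: eq_bigr => i _.
  by rewrite exprS mulN1r mulNr.
rewrite -sumrN; apply: eq_bigr => j _.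
by rewrite /= form_swap1 // addSn addnS !exprS !mulN1r opprK mulrN.
Qed.

Lemma ext_d_lin w z h t : is_form w -> is_form z ->
  ext_d_raw (fun s => h * w s + z s) t =
  wedge_raw (fun Y => Y h) w t + h * ext_d_raw w t + ext_d_raw z t.
Proof.
elim: t w z => [|X t IH] w z fw fz.
  by rewrite !ext_d_nil wedge_nil mulr0 !addr0.
rewrite !ext_d_cons //; last exact: isform_linear.
rewrite lie_lin wedge_cons.
have -> : contract_raw X (fun s => h * w s + z s) =
  fun s => h * contract_raw X w s + contract_raw X z s by [].
by rewrite IH; [ring|exact: isform_contract..].
Qed.

Lemma ext_d0 t : ext_d_raw (fun=> 0) t = 0.
Proof.
rewrite /ext_d_raw !big1 ?addr0 // => i _ /=; last by rewrite vfield0 mulr0.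
by rewrite big1 // => j _; rewrite mulr0.
Qed.

Lemma lie_linX w h X Y t : is_form w ->
  lie_raw w (h *: X + Y) t =
  h * lie_raw w X t + wedge_raw (fun Z => Z h) (contract_raw X w) t + lie_raw w Y t.
Proof.
elim: t w => [|Z t IH] w fw.
  by rewrite wedge_nil /lie_raw !big_ord0 vfieldDE vfieldZE !subr0 addr0.
rewrite !lie_cons IH; last exact: isform_contract.
rewrite bracket_linl !form_lin1; try exact: fw.1.
rewrite wedge_cons.
have -> : wedge_raw (fun Z => Z h) (contract_raw X (contract_raw Z w)) t =
  - wedge_raw (fun Z => Z h) (contract_raw Z (contract_raw X w)) t.
  rewrite /wedge_raw -sumrN; apply: eq_bigr => i _.
  by rewrite /contract_raw form_swap1 // !mulrN.
by rewrite /contract_raw; ring.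
Qed.

Lemma ext_d_subproof (w : diff_form) :
  multilinear (ext_d_raw w) /\ alternating (ext_d_raw w).
Proof.
case: w => w lw aw /=; have {lw aw} fw : is_form w by [].
apply: alternatingP.
  move=> s; elim: s w fw => [|Z s IH] w fw t h X Y /=.
    rewrite !ext_d_cons // lie_linX // contract_lin; last exact: fw.1.
    by rewrite ext_d_lin; [ring|exact: isform_contract..].
  rewrite !ext_d_cons // lie_multilinear // IH; first by ring.
  exact: isform_contract.
move=> s; elim: s w fw => [|Z s IH] w fw X t /=.
  rewrite !ext_d_cons //; last exact: isform_contract.
  rewrite contractK ?ext_d0; last exact: isform_adj.
  by rewrite lie_cons bracketxx (form_lin0 [::]) /=; [ring|exact: fw.1].
rewrite ext_d_cons // lie_adjacent // IH ?subr0 //.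
exact: isform_contract.
Qed.

Fact form_zero_subproof : multilinear (fun=> 0) /\ alternating (fun=> 0).
Proof. exact: isform0. Qed.

Fact form_linear_subproof (h : A) (w z : diff_form) :
  multilinear (fun s => h * w s + z s) /\
  alternating (fun s => h * w s + z s).
Proof. by case: w z => [w lw aw] [z lz az]; exact: isform_linear. Qed.

Fact contract_subproof X (w : diff_form) :
  multilinear (contract_raw X w) /\ alternating (contract_raw X w).
Proof. by case: w => w lw aw; exact: isform_contract. Qed.

End Forms.

Section FormModule.
Context (R : realType) (n : nat) (M : smoothManifold R n).
Local Notation A := (smooth_fun M).
Local Notation diff_form := (diff_form M).

Definition mk_form w (h : multilinear w /\ alternating w) : diff_form :=
  Form h.1 h.2.

Definition form_zero := mk_form (form_zero_subproof M).

Fact form_opp_subproof (w : diff_form) :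
  multilinear (fun s => - w s) /\ alternating (fun s => - w s).
Proof.
have -> : (fun s => - w s) = fun s => -1 * w s + form_zero s.
  by apply/funext => s /=; rewrite mulN1r addr0.
exact: form_linear_subproof.
Qed.
Definition form_opp w := mk_form (form_opp_subproof w).

Fact form_add_subproof (w z : diff_form) :
  multilinear (fun s => w s + z s) /\ alternating (fun s => w s + z s).
Proof.
have -> : (fun s => w s + z s) = fun s => 1 * w s + z s.
  by apply/funext => s /=; rewrite mul1r.
exact: form_linear_subproof.
Qed.
Definition form_add w z := mk_form (form_add_subproof w z).

Fact form_scale_subproof (h : A) (w : diff_form) :
  multilinear (fun s => h * w s) /\ alternating (fun s => h * w s).
Proof.
have -> : (fun s => h * w s) = fun s => h * w s + form_zero s.
  by apply/funext => s /=; rewrite addr0.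
exact: form_linear_subproof.
Qed.
Definition form_scale h w := mk_form (form_scale_subproof h w).

Fact form_addA : associative form_add.
Proof. by move=> w y z; apply: formP => s /=; rewrite addrA. Qed.
Fact form_addC : commutative form_add.
Proof. by move=> w z; apply: formP => s /=; rewrite addrC. Qed.
Fact form_add0 : left_id form_zero form_add.
Proof. by move=> w; apply: formP => s /=; rewrite add0r. Qed.
Fact form_addN : left_inverse form_zero form_opp form_add.
Proof. by move=> w; apply: formP => s /=; rewrite addNr. Qed.
HB.instance Definition _ := GRing.isZmodule.Build diff_form
  form_addA form_addC form_add0 form_addN.

Fact form_scaleA a b w : form_scale a (form_scale b w) = form_scale (a * b) w.
Proof. by apply: formP => s /=; rewrite mulrA. Qed.
Fact form_scale1 : left_id 1 form_scale.
Proof. by move=> w; apply: formP => s /=; rewrite mul1r. Qed.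
Fact form_scaleDr : right_distributive form_scale +%R.
Proof. by move=> a w z; apply: formP => s /=; rewrite mulrDr. Qed.
Fact form_scaleDl w : {morph form_scale^~ w : a b / a + b}.
Proof. by move=> a b; apply: formP => s /=; rewrite mulrDl. Qed.
HB.instance Definition _ := GRing.Zmodule_isLmodule.Build A diff_form
  form_scaleA form_scale1 form_scaleDr form_scaleDl.

End FormModule.

Section OneForms.
Context (R : realType) (n : nat) (M : smoothManifold R n).
Local Notation A := (smooth_fun M).
Local Notation V := (vfield M).

(* Sections of T*M, the dual module of vector fields. *)
Record oneform := OneForm {
  oneform_fun :> V -> A;
  oneform_lin : forall (h : A) X Y,
    oneform_fun (h *: X + Y) = h * oneform_fun X + oneform_fun Y }.

HB.instance Definition _ := gen_eqMixin oneform.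
HB.instance Definition _ := gen_choiceMixin oneform.

Lemma oneformP (a b : oneform) : (forall X, a X = b X) -> a = b.
Proof.
case: a b => [a la] [b lb] /= /funext ab; subst b.
by congr OneForm; exact: Prop_irrelevance.
Qed.

Fact oneform_zero_subproof (h : A) (X Y : V) : 0 = h * 0 + 0 :> A.
Proof. by ring. Qed.
Definition oneform_zero := @OneForm (fun=> 0) oneform_zero_subproof.

Fact oneform_opp_subproof (a : oneform) h X Y :
  - a (h *: X + Y) = h * - a X + - a Y.
Proof. by rewrite oneform_lin; ring. Qed.
Definition oneform_opp (a : oneform) := OneForm (oneform_opp_subproof a).

Fact oneform_add_subproof (a b : oneform) h X Y :
  a (h *: X + Y) + b (h *: X + Y) = h * (a X + b X) + (a Y + b Y).
Proof. by rewrite !oneform_lin; ring. Qed.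
Definition oneform_add (a b : oneform) := @OneForm (fun X => a X + b X)
  (oneform_add_subproof a b).

Fact oneform_scale_subproof k (a : oneform) h X Y :
  k * a (h *: X + Y) = h * (k * a X) + k * a Y.
Proof. by rewrite oneform_lin; ring. Qed.
Definition oneform_scale k (a : oneform) := @OneForm (fun X => k * a X)
  (oneform_scale_subproof k a).

Fact oneform_addA : associative oneform_add.
Proof. by move=> a b c; apply: oneformP => X /=; rewrite addrA. Qed.
Fact oneform_addC : commutative oneform_add.
Proof. by move=> a b; apply: oneformP => X /=; rewrite addrC. Qed.
Fact oneform_add0 : left_id oneform_zero oneform_add.
Proof. by move=> a; apply: oneformP => X /=; rewrite add0r. Qed.
Fact oneform_addN : left_inverse oneform_zero oneform_opp oneform_add.
Proof. by move=> a; apply: oneformP => X /=; rewrite addNr. Qed.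
HB.instance Definition _ := GRing.isZmodule.Build oneform
  oneform_addA oneform_addC oneform_add0 oneform_addN.

Fact oneform_scaleA h k a :
  oneform_scale h (oneform_scale k a) = oneform_scale (h * k) a.
Proof. by apply: oneformP => X /=; rewrite mulrA. Qed.
Fact oneform_scale1 : left_id 1 oneform_scale.
Proof. by move=> a; apply: oneformP => X /=; rewrite mul1r. Qed.
Fact oneform_scaleDr : right_distributive oneform_scale +%R.
Proof. by move=> h a b; apply: oneformP => X /=; rewrite mulrDr. Qed.
Fact oneform_scaleDl a : {morph oneform_scale^~ a : h k / h + k}.
Proof. by move=> h k; apply: oneformP => X /=; rewrite mulrDl. Qed.
HB.instance Definition _ := GRing.Zmodule_isLmodule.Build A oneform
  oneform_scaleA oneform_scale1 oneform_scaleDr oneform_scaleDl.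

Fact form_of_oneform_subproof (a : oneform) :
  let w s := if s is [:: X] then a X else 0 in
  multilinear w /\ alternating w.
Proof.
split=> [[|Z s] [|U t] h X Y|[|X [|Y s]]] //=.
- exact: oneform_lin.
- by rewrite mulr0 addr0.
- by case: s => [|? ?]; rewrite /= mulr0 addr0.
- by case: s => [|? ?]; rewrite /= mulr0 addr0.
Qed.
Definition form_of_oneform a := mk_form (form_of_oneform_subproof a).

Fact form_one_subproof :
  let w (s : seq V) := if s is [::] then 1 else 0 : A in
  multilinear w /\ alternating w.
Proof.
by split=> [[|Z s] t h X Y|[|X s]] //=; rewrite mulr0 addr0.
Qed.
Definition form_one : diff_form M := mk_form form_one_subproof.

Definition contraction (X : V) (w : diff_form M) : diff_form M :=
  mk_form (contract_subproof X w).
Definition wedge1 (a : oneform) (w : diff_form M) : diff_form M :=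
  mk_form (wedge_subproof w (@oneform_lin a)).
Definition ext_d (w : diff_form M) : diff_form M := mk_form (ext_d_subproof w).

Fact lie_oneform_subproof (X : V) (b : oneform) h Y Z :
  X (b (h *: Y + Z)) - b (bracket X (h *: Y + Z)) =
  h * (X (b Y) - b (bracket X Y)) + (X (b Z) - b (bracket X Z)).
Proof.
rewrite bracket_linr !oneform_lin vfieldD vfield_leibniz; ring.
Qed.
Definition lie_oneform (X : V) (b : oneform) := @OneForm
  (fun Y => X (b Y) - b (bracket X Y)) (lie_oneform_subproof X b).

Fact contract_d_subproof (Y : V) (a : oneform) h X Z :
  let da := ext_d (form_of_oneform a) in
  da [:: Y; h *: X + Z] = h * da [:: Y; X] + da [:: Y; Z].
Proof. exact: (form_multilinear (ext_d (form_of_oneform a)) [:: Y]). Qed.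
Definition contract_d (Y : V) (a : oneform) := @OneForm
  (fun Z => ext_d (form_of_oneform a) [:: Y; Z]) (contract_d_subproof Y a).

End OneForms.

(* Sections of the generalized tangent bundle, as a module over smooth
   functions. *)
Notation gtsection M := (vfield M * oneform M)%type.

Section LinearAlgebra.
Context (R : realType) (W : lmodType R).
Implicit Types (f s : W -> W) (P Q : {poly R}).

Definition poly_act Q f (x : W) := \sum_(i < size Q) Q`_i *: iter i f x.

Definition annihilates Q f := forall x, poly_act Q f x = 0.

Definition minimal_polynomial f P :=
  [/\ P \is monic, annihilates P f & forall Q, annihilates Q f -> P %| Q].

(* [z] is an eigenvalue of the complexification of [f], with eigenvector
   [x + i y]. *)
Definition complex_eigenvalue f (z : R[i]) := exists x y : W,
  [/\ (x, y) <> (0, 0),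
      f x = complex.Re z *: x - complex.Im z *: y &
      f y = complex.Im z *: x + complex.Re z *: y].

Definition subspace (U : set W) :=
  U 0 /\ forall (c : R) x y, U x -> U y -> U (c *: x + y).

(* Every invariant subspace has an invariant complement. *)
Definition semisimple f := forall U, subspace U -> (forall x, U x -> U (f x)) ->
  exists U', [/\ subspace U', forall x, U' x -> U' (f x),
    U `&` U' `<=` [set 0] &
    forall x, exists u u', [/\ U u, U' u' & x = u + u']].

Definition nilpotent f := exists k, forall x, iter k f x = 0.

(* [f = s + nu] is the Jordan-Chevalley decomposition of [f]. *)
Definition jordan_semisimple_part f s := exists nu : W -> W,
  [/\ semisimple s, nilpotent nu, forall x, f x = s x + nu x &
      forall x, s (nu x) = nu (s x)].

End LinearAlgebra.

Section Fiber.
Context (R : realType) (n : nat) (M : smoothManifold R n) (p : M).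
Local Notation A := (smooth_fun M).
Local Notation G := (gtsection M).

Definition vanishing_at : {pred G} := fun x =>
  `[< exists2 r : seq (A * G), (forall q, q \in r -> q.1 p = 0) &
        x = \sum_(q <- r) q.1 *: q.2 >].

Fact vanishing_at_zmod_closed : zmod_closed vanishing_at.
Proof.
split=> [|_ _ /asboolP[r r0 ->] /asboolP[t t0 ->]]; apply/asboolP.
  by exists [::] => //; rewrite big_nil.
exists (r ++ [seq (q.1, - q.2) | q <- t]).
  by move=> q; rewrite mem_cat => /orP[/r0//|/mapP[q' /t0 q'0 ->]].
rewrite big_cat big_map /= -sumrN; congr (_ + _); apply: eq_bigr => q _.
by rewrite scalerN.
Qed.
HB.instance Definition _ :=
  GRing.isZmodClosed.Build G vanishing_at vanishing_at_zmod_closed.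

Lemma vanishing_atZ (h : A) x :
  x \in vanishing_at -> h *: x \in vanishing_at.
Proof.
move=> /asboolP[r r0 ->]; apply/asboolP.
exists [seq (q.1, h *: q.2) | q <- r].
  by move=> _ /mapP[q /r0 q0 ->].
rewrite big_map scaler_sumr; apply: eq_bigr => q _ /=.
by rewrite !scalerA mulrC.
Qed.

Lemma vanishing_at_linear (f : {linear G -> G}) x :
  x \in vanishing_at -> f x \in vanishing_at.
Proof.
move=> /asboolP[r r0 ->]; apply/asboolP.
exists [seq (q.1, f q.2) | q <- r].
  by move=> _ /mapP[q /r0 q0 ->].
by rewrite big_map linear_sum; apply: eq_bigr => q _ /=; rewrite linearZ.
Qed.

(* The fiber at [p] of the generalized tangent bundle, as the quotient of its
   sections by the submodule m_p Gamma, where m_p is the ideal of the smooth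
   functions that vanish at [p]. *)
Definition fiber := Quotient.quot vanishing_at.

HB.instance Definition _ := GRing.Zmodule.on fiber.

Definition value (x : G) : fiber :=
  (\pi_(Quotient.quot vanishing_at) x)%qT.

Lemma valueP x y : value x = value y <-> x - y \in vanishing_at.
Proof. by rewrite Quotient.idealrBE; split=> [/eqP|/eqP]. Qed.

Definition representative (u : fiber) : G := repr u.

Lemma representativeK u : value (representative u) = u.
Proof. exact: reprK. Qed.

Lemma valueB x y : value (x - y) = value x - value y.
Proof. exact: raddfB. Qed.

Lemma valueD x y : value (x + y) = value x + value y.
Proof. exact: raddfD. Qed.

Definition fiber_scale (c : R) (u : fiber) : fiber :=
  value (const_fun M c *: representative u).

Lemma valueZ c x : fiber_scale c (value x) = value (const_fun M c *: x).
Proof.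
apply/valueP; rewrite -scalerBr; apply: vanishing_atZ.
by apply/valueP; rewrite representativeK.
Qed.

Fact fiber_scaleA a b u :
  fiber_scale a (fiber_scale b u) = fiber_scale (a * b) u.
Proof.
by rewrite -(representativeK u) !valueZ scalerA const_funM.
Qed.
Fact fiber_scale1 : left_id 1 fiber_scale.
Proof.
by move=> u; rewrite -(representativeK u) valueZ const_fun1 scale1r.
Qed.
Fact fiber_scaleDr : right_distributive fiber_scale +%R.
Proof.
move=> a u v; rewrite -(representativeK u) -(representativeK v) -valueD.
by rewrite !valueZ -valueD scalerDr.
Qed.
Fact fiber_scaleDl u : {morph fiber_scale^~ u : a b / a + b}.
Proof.
move=> a b; rewrite -(representativeK u) !valueZ -valueD.
by rewrite const_funD scalerDl.
Qed.
HB.instance Definition _ := GRing.Zmodule_isLmodule.Build R fiber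
  fiber_scaleA fiber_scale1 fiber_scaleDr fiber_scaleDl.

Definition fiber_map (f : {linear G -> G}) (u : fiber) : fiber :=
  value (f (representative u)).

Lemma fiber_mapE f x : fiber_map f (value x) = value (f x).
Proof.
apply/valueP; rewrite -linearB; apply: vanishing_at_linear.
by apply/valueP; rewrite representativeK.
Qed.

End Fiber.

Section Operators.
Context (R : realType) (n : nat) (M : smoothManifold R n).
Local Notation A := (smooth_fun M).
Local Notation Omega := (diff_form M).
Local Notation G := (gtsection M).

(* Operators act on the global sections Omega(M); they are meant to be
   R-linear, real scalars acting through constant functions. *)
Definition Rlinear (psi : Omega -> Omega) := forall (c : R) w z,
  psi (const_fun M c *: w + z) = const_fun M c *: psi w + psi z.

Definition fun_op (f : A) (w : Omega) : Omega := f *: w.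

Definition section_op (x : G) (w : Omega) : Omega :=
  contraction x.1 w + wedge1 x.2 w.

Fact parity_proj_subproof (b : bool) (w : Omega) :
  multilinear (fun s => if odd (size s) == b then w s else 0) /\
  alternating (fun s => if odd (size s) == b then w s else 0).
Proof.
split=> [s t h X Y|s us].
  rewrite !size_cat /=; case: ifP => _; first exact: form_multilinear.
  by rewrite mulr0 addr0.
by case: ifP => // _; exact: form_alternating.
Qed.
Definition parity_proj b w : Omega := mk_form (parity_proj_subproof b w).

(* The component of degree [b] mod 2 of an operator. *)
Definition parity_part (b : bool) (psi : Omega -> Omega) (w : Omega) : Omega :=
  parity_proj b (psi (parity_proj false w)) +
  parity_proj (~~ b) (psi (parity_proj true w)).

(* The graded commutator [psi chi - (-1)^(kl) chi psi], extended
   bi-additively; the sign only depends on degrees mod 2. *)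
Definition gcomm (psi chi : Omega -> Omega) (w : Omega) : Omega :=
  psi (chi w) - \sum_(k : bool) \sum_(l : bool)
    (-1) ^+ (k && l) *: parity_part l chi (parity_part k psi w).

Definition poly_ad (P : {poly R}) (psi chi : Omega -> Omega) (w : Omega) :=
  \sum_(i < size P) const_fun M P`_i *: iter i (gcomm psi) chi w.

End Operators.

Section GeneralizedPolynomialStructures.
Context (R : realType) (n : nat) (M : smoothManifold R n).
Local Notation A := (smooth_fun M).
Local Notation Omega := (diff_form M).
Local Notation G := (gtsection M).
Local Notation C := R[i].
Implicit Types (phi psi : {linear G -> G}) (P : {poly R}).

Definition pairing (x y : G) : A :=
  const_fun M 2^-1 * (x.2 y.1 + y.2 x.1).

Definition skew_symmetric phi :=
  forall x y, pairing (phi x) y = - pairing x (phi y).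

Definition generalized_polynomial_structure phi P :=
  [/\ skew_symmetric phi, P \is monic, (1 < size P)%N &
      forall p : M, minimal_polynomial (@fiber_map _ _ _ p phi) P].

Definition Sigma phi : set C :=
  [set z | exists p : M, complex_eigenvalue (@fiber_map _ _ _ p phi) z].

Definition non_resonant phi P := forall la mu nu : C,
  Sigma phi la -> Sigma phi mu -> Sigma phi nu ->
  (la + mu) * (la + nu) * (mu + nu) != 0 ->
  (map_poly (real_complex R) P).[la + mu + nu] != 0.

(* The properties that determine the operator phi~: it is even, i.e. its
   component of odd degree is zero, [phi~, f] = 0 for functions f,
   [phi~, x] = phi x for sections x, and phi~(1) has degree 2. *)
Definition tilde_of phi (phit : Omega -> Omega) :=
  [/\ Rlinear phit,
      forall w, parity_part true phit w = 0,
      forall f w, gcomm phit (fun_op f) w = 0,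
      forall x w, gcomm phit (section_op x) w = section_op (phi x) w &
      forall s, size s <> 2%N -> phit (form_one M) s = 0].

Definition minimal_torsion P (phit : Omega -> Omega) (x y : G) :=
  gcomm (gcomm (section_op x) (poly_ad P phit (@ext_d _ _ M))) (section_op y).

Definition minimal phi P := exists2 phit, tilde_of phi phit &
  forall x y w, minimal_torsion P phit x y w = 0.

Definition semisimple_part phi phi_s := forall p : M,
  jordan_semisimple_part (@fiber_map _ _ _ p phi) (@fiber_map _ _ _ p phi_s).

Definition dorfman (x y : G) : G :=
  (bracket x.1 y.1, lie_oneform x.1 y.2 - contract_d y.1 x.2).

Definition torsion psi (x y : G) : G :=
  psi (psi (dorfman x y)) + dorfman (psi x) (psi y) -
  psi (dorfman (psi x) y + dorfman x (psi y)).

Definition shifted_torsion psi (x y : G) : G :=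
  torsion psi (psi x) y + torsion psi x (psi y).

Definition weak_generalized_nijenhuis psi :=
  forall x y, shifted_torsion psi x y = 0.

End GeneralizedPolynomialStructures.

(* Main.v *)
(* Write psi for the semisimple part and let a, b, c act on brackets B by
   phi o B, B(phi, .), B(., phi).  Passing from an operator E to [phi~, E]
   applies a - b - c to the derived bracket [[x, E], y], so minimality of phi says
   that P(a - b - c) annihilates the Dorfman bracket D, which is derived from d.
   Let A, B, C be the analogous operators for psi; then the weak Nijenhuis
   condition reads (B + C)(A - B)(A - C) D = 0.  On each fiber psi is annihilated
   by the radical p of P, and phi - psi is nilpotent of an order bounded uniformly
   in the fiber.  In the commutative ring generated by these six operators,
   modulo the annihilator of D, the Chinese remainder theorem lets one replace
   A, B, C by roots la, mu, nu of P.  Then a - b - c differs from la - mu - nu by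
   a nilpotent, so either P(la - mu - nu) = 0, and non-resonance gives
   (mu + nu)(la - mu)(la - nu) = 0, or 1 annihilates D.  The signs agree with the
   definition of non-resonance because phi is skew, which makes the set of roots
   of P symmetric. *)
(* Before [Defs], whose [subspace] must shadow the one of [topology]. *)
From mathcomp Require Import topology.
Require Import Defs.
From mathcomp Require Import all_boot all_order all_algebra.
From mathcomp Require Import all_classical all_reals.
From mathcomp Require Import separable complex ring lra.

Set Implicit Arguments.
Unset Strict Implicit.
Unset Printing Implicit Defensive.

Import Order.TTheory GRing.Theory Num.Theory.
Local Open Scope ring_scope.

(** * Ideals in commutative rings *)

Section Ideals.
Context (T : comNzRingType).
Implicit Types (J : T -> Prop) (x y t : T).

(** Ideals are predicates because membership will be an equation between sections. They need not be
    proper: reaching [J 1] is how an impossible case is closed. *)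
Definition ideal J :=
  [/\ J 0, forall x y, J x -> J y -> J (x + y) & forall t x, J x -> J (t * x)].

Definition radical J x := exists k, J (x ^+ k).

Lemma idealD J x y : ideal J -> J x -> J y -> J (x + y).
Proof. by case=> _ h _; exact: h. Qed.

Lemma idealMl J t x : ideal J -> J x -> J (t * x).
Proof. by case=> _ _; exact. Qed.

Lemma idealMr J t x : ideal J -> J x -> J (x * t).
Proof. by rewrite mulrC; exact: idealMl. Qed.

Lemma idealN J x : ideal J -> J x -> J (- x).
Proof. by move=> iJ Jx; rewrite -mulN1r; exact: idealMl. Qed.

Lemma idealB J x y : ideal J -> J x -> J y -> J (x - y).
Proof. by move=> iJ Jx Jy; apply: idealD => //; exact: idealN. Qed.

Lemma ideal_sum J I (r : seq I) (Q : pred I) (F : I -> T) : ideal J ->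
  (forall i, Q i -> J (F i)) -> J (\sum_(i <- r | Q i) F i).
Proof.
by case=> J0 JD _ JF; apply: (big_ind J).
Qed.

Lemma ideal_radical J : ideal J -> ideal (radical J).
Proof.
move=> iJ; have JX x k l : J (x ^+ k) -> (k <= l)%N -> J (x ^+ l).
  by move=> Jx /subnK <-; rewrite exprD; exact: idealMl.
split=> [|x y [k Jk] [l Jl]|t x [k Jk]].
- by exists 1%N; rewrite expr1; case: iJ.
(* In each binomial term either the exponent of [y] is at least [l] or that of [x] is at least
   [k]. *)
- exists (k + l)%N; rewrite exprDn; apply: ideal_sum => // -[i /= ilt] _.
  rewrite -mulr_natl; apply: idealMl => //.
  have [lei|lti] := leqP l i.
    by apply: idealMl => //; exact: JX lei.
  apply: idealMr => //; apply: (JX _ _ _ Jk).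
  by rewrite leq_subRL ?(leq_trans (ltnW lti)) ?leq_addl // addnC leq_add2l ltnW.
- by exists k; rewrite exprMn; exact: idealMl.
Qed.

Lemma sub_radical J x : J x -> radical J x.
Proof. by exists 1%N; rewrite expr1. Qed.

Lemma radicalX J x k : radical J (x ^+ k) -> radical J x.
Proof. by case=> l; rewrite -exprM; exists (k * l)%N. Qed.

Lemma radical1 J : radical J 1 -> J 1.
Proof. by case=> k; rewrite expr1n. Qed.

(** By the factor theorem over [T], [x - y] divides [p.[x] - p.[y]]. *)
Lemma ideal_horner_sub J (p : {poly T}) x y :
  ideal J -> J (x - y) -> J (p.[x] - p.[y]).
Proof.
move=> iJ Jxy; have : root (p - p.[y]%:P) y.
  by rewrite /root !hornerE subrr.
case/factor_theorem => q /(congr1 (horner^~ x)).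
by rewrite !hornerE => ->; exact: idealMl.
Qed.

(* Taylor: [p(f) = p(s) + (f - s) a] with [a = p'(s) + (f - s) r].  Modulo [J],
   [p'(s)] is invertible by Bezout, hence so is [a], as [f - s] is nilpotent. *)
Lemma ideal_separable_uniform J (p : {poly T}) (u v : {poly T}) f s m k :
  ideal J -> u * p + v * p^`() = 1 -> J p.[s] -> J (p.[f] ^+ m) ->
  J ((f - s) ^+ k) -> J ((f - s) ^+ m).
Proof.
move=> iJ uv Jps Jpf Jk; set nu := f - s in Jk *.
have [r fE] : exists r, p.[f] = p.[s] + nu * (p^`().[s] + nu * r).
  have sE : f = s + nu by rewrite /nu addrCA subrr addr0.
  rewrite sE; elim/poly_ind: p {u v uv Jps Jpf} => [|p c [r IH]].
    by exists 0; rewrite deriv0 !horner0; ring.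
  exists (p^`().[s] + r * (s + nu)).
  by rewrite derivMXaddC !hornerMXaddC hornerD hornerMX IH; ring.
(* The colon ideal of [J] by [nu ^+ m]: the goal says that it contains 1, and it is enough that its
   radical does. *)
pose J' t := J (t * nu ^+ m).
have iJ' : ideal J'.
  split; rewrite /J'.
  - by rewrite mul0r; case: iJ.
  - by move=> x y Jx Jy; rewrite mulrDl; exact: idealD.
  - by move=> t x Jx; rewrite -mulrA; exact: idealMl.
have JJ' x : J x -> J' x by move=> Jx; exact: idealMr.
suff : J' 1 by rewrite /J' mul1r.
apply: radical1; have iR := ideal_radical iJ'.
set a := p^`().[s] + nu * r in fE.
(* Modulo [J], [a * nu] is [p.[f]], whose [m]-th power lies in [J]; so [a ^+ m] is in the colon
   ideal. *)
have Ra : radical J' a.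
  exists m; rewrite /J' -exprMn.
  have -> : a * nu = p.[f] - p.[s] by rewrite fE; ring.
  have : J (p.[f] ^+ m - (p.[f] - p.[s]) ^+ m).
    have := @ideal_horner_sub J 'X^m p.[f] (p.[f] - p.[s]) iJ.
    rewrite !hornerXn; apply; have -> : p.[f] - (p.[f] - p.[s]) = p.[s] by ring.
    exact: Jps.
  by move=> /(idealB iJ Jpf); rewrite opprB addrCA subrr addr0.
have Rnu : radical J' nu by exists k; exact: JJ'.
have Rp : radical J' p.[s] by apply: sub_radical; exact: JJ'.
have -> : 1 = u.[s] * p.[s] + v.[s] * (a - r * nu).
  have := congr1 (horner^~ s) uv; rewrite hornerD !hornerM hornerC => <-.
  by rewrite /a; ring.
by apply: idealD => //; apply: idealMl => //; apply: idealB => //; apply: idealMl.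
Qed.

End Ideals.

(** * Splitting an ideal along the distinct roots of a polynomial *)

Section SplitIdeals.
Context (F : fieldType) (T : comNzRingType) (iota : {rmorphism F -> T}).
Implicit Types (J : T -> Prop).

(* Chinese remainder theorem, with [J' t] for every ideal [J'] containing [J] and
   [A - z] in place of membership in the quotient by [J + (A - z)]. *)
Lemma ideal_split J (rs : seq F) A t : ideal J -> uniq rs ->
  J (\prod_(z <- rs) (A - iota z)) ->
  (forall z J', z \in rs -> ideal J' -> (forall x, J x -> J' x) ->
     J' (A - iota z) -> J' t) -> J t.
Proof.
elim: rs J => [|z rs IH] J iJ /=.
  by rewrite big_nil => _ J1 _; rewrite -[t]mulr1; exact: idealMl.
case/andP=> nz urs; rewrite big_cons => Jprod Jt.
set q := \prod_(z <- rs) _ in Jprod.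
(* Two colon ideals: [J1] contains [A - iota z], so the hypothesis at [z] applies to it; [J2]
   contains [q], so the induction does. Hence [J] contains both [q * t] and [(A - iota z) * t]. *)
pose J1 x := J (q * x); pose J2 x := J ((A - iota z) * x).
have id2 a : ideal (fun x => J (a * x)).
  split; first by rewrite mulr0; case: iJ.
    by move=> x y Jx Jy; rewrite mulrDr; exact: idealD.
  by move=> b x Jx; rewrite mulrCA; exact: idealMl.
have {}Jt1 : J1 t.
  apply: (Jt z); rewrite ?inE ?eqxx //; first exact: id2.
    by move=> x Jx; exact: idealMl.
  by rewrite /J1 mulrC.
have {}Jt2 : J2 t.
  apply: IH => // [|y J' yrs iJ' J2' J'y]; first exact: id2.
  apply: (Jt y) => //; first by rewrite inE yrs orbT.
  by move=> x Jx; apply: J2'; exact: idealMl.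
(* [c] is the value of [q] at [z], nonzero since the roots are distinct; so [q] and [A - iota z]
   generate the unit ideal, which recovers [t]. *)
pose c := \prod_(y <- rs) (z - y).
have c0 : c != 0.
  rewrite prodf_seq_neq0; apply/allP => y yrs /=.
  by rewrite subr_eq0; apply: contraNneq nz => ->.
have [r qE] : exists r, q = iota c + r * (A - iota z).
  have : root (\prod_(y <- rs) ('X - (iota y)%:P) - (iota c)%:P) (iota z).
    rewrite /root !hornerE horner_prod rmorph_prod subr_eq0; apply/eqP.
    by apply: eq_bigr => y _; rewrite !hornerE rmorphB.
  case/factor_theorem => r /(congr1 (horner^~ A)).
  rewrite !hornerE horner_prod => rE; exists r.[A]; rewrite -rE.
  rewrite addrC subrK; apply: eq_bigr => y _; by rewrite !hornerE.
have -> : t = iota c^-1 * (q * t - r * ((A - iota z) * t)).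
  have ciota : iota c^-1 * iota c = 1 by rewrite -rmorphM mulVf // rmorph1.
  rewrite qE -[LHS]mul1r -ciota; ring.
by apply: idealMl => //; apply: idealB => //; apply: idealMl.
Qed.

Lemma non_resonant_ideal J (rs : seq F) (P : {poly F}) A B C a b c k :
  ideal J -> uniq rs ->
  J (\prod_(z <- rs) (A - iota z)) -> J (\prod_(z <- rs) (B - iota z)) ->
  J (\prod_(z <- rs) (C - iota z)) ->
  J ((a - A) ^+ k) -> J ((b - B) ^+ k) -> J ((c - C) ^+ k) ->
  J (map_poly iota P).[a - b - c] ->
  (forall la mu nu, la \in rs -> mu \in rs -> nu \in rs ->
     (mu + nu) * (la - mu) * (la - nu) != 0 -> P.[la - mu - nu] != 0) ->
  J ((B + C) * (A - B) * (A - C)).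
Proof.
move=> iJ urs JA JB JC Ja Jb Jc JP nonres.
apply: (ideal_split iJ urs JA) => la J1 lar iJ1 sJ1 J1A.
apply: (ideal_split iJ1 urs (sJ1 _ JB)) => mu J2 mur iJ2 sJ2 J2B.
apply: (ideal_split iJ2 urs (sJ2 _ (sJ1 _ JC))) => nu J3 nur iJ3 sJ3 J3C.
have J3' x : J x -> J3 x by move=> /sJ1/sJ2/sJ3.
have J3B := sJ3 _ J2B; have J3A := sJ3 _ (sJ2 _ J1A).
have [e|/(nonres _ _ _ lar mur nur) Pn0] :=
    eqVneq ((mu + nu) * (la - mu) * (la - nu)) 0.
  have := congr1 iota e.
  rewrite !(rmorphM, rmorphB, rmorphD, rmorph0) => {}e.
  rewrite -[X in J3 X]subr0 -e.
  set x := iota la in e J3A *; set y := iota mu in e J3B *.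
  set z := iota nu in e J3C *.
  (* Telescoping: the three factors are replaced one at a time by their values at the roots. *)
  have -> : (B + C) * (A - B) * (A - C) - (y + z) * (x - y) * (x - z) =
     (A - B) * (A - C) * ((B - y) + (C - z)) +
     (y + z) * (A - C) * ((A - x) - (B - y)) +
     (y + z) * (x - y) * ((A - x) - (C - z)) by ring.
  apply: idealD => //; first apply: idealD => //; apply: idealMl => //.
  - exact: idealD.
  - exact: idealB.
  - exact: idealB.
(* Now [P] takes an invertible value at [la - mu - nu], congruent modulo the radical of [J3] to its
   value at [a - b - c], which lies in [J]; so [J3] is the whole ring. *)
suff : J3 1 by move=> J1'; rewrite -[X in J3 X]mulr1; exact: idealMl.
apply: radical1; have iR := ideal_radical iJ3.
have Rn x y z : J ((x - y) ^+ k) -> J3 (y - z) -> radical J3 (x - z).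
  move=> Jk J3y; rewrite -(subrK y x) -addrA; apply: idealD => //.
    by exists k; exact: J3'.
  exact: sub_radical.
have Rd : radical J3 (a - b - c - iota (la - mu - nu)).
  rewrite !rmorphB; have -> : a - b - c - (iota la - iota mu - iota nu) =
    (a - iota la) - (b - iota mu) - (c - iota nu) by ring.
  apply: idealB => //; first apply: idealB => //.
  - exact: Rn J3A.
  - exact: Rn J3B.
  - exact: Rn J3C.
have := ideal_horner_sub (map_poly iota P) iR Rd.
rewrite horner_map => /(idealB iR (sub_radical (J3' _ JP))).
rewrite opprB addrCA subrr addr0 => Rc.
have -> : 1 = iota (P.[la - mu - nu])^-1 * iota P.[la - mu - nu].
  by rewrite -rmorphM mulVf // rmorph1.
exact: idealMl.
Qed.

End SplitIdeals.

(** * Commuting operators as a module over a commutative ring *)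

Section Actions.

(** A module structure kept as a property of [act], since the acting ring is produced inside an
    existential and changes at each induction step. *)
Record is_action (T : comNzRingType) (W : zmodType) (act : T -> W -> W) := IsAction {
  actDr : forall t u v, act t (u + v) = act t u + act t v;
  actDl : forall s t w, act (s + t) w = act s w + act t w;
  actM : forall s t w, act (s * t) w = act s (act t w);
  act1 : forall w, act 1 w = w }.

Definition commuting (W : zmodType) (f g : W -> W) := forall w, f (g w) = g (f w).

Definition additive_map (W W' : zmodType) (f : W -> W') :=
  forall u v, f (u + v) = f u + f v.

Lemma additive_map0 (W W' : zmodType) (f : W -> W') : additive_map f -> f 0 = 0.
Proof. by move=> fD; apply: (addIr (f 0)); rewrite -fD !add0r. Qed.

Lemma additive_mapN (W W' : zmodType) (f : W -> W') u :
  additive_map f -> f (- u) = - f u.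
Proof.
by move=> fD; apply: (addIr (f u)); rewrite -fD !addNr; exact: additive_map0.
Qed.

Lemma additive_mapB (W W' : zmodType) (f : W -> W') u v :
  additive_map f -> f (u - v) = f u - f v.
Proof. by move=> fD; rewrite fD additive_mapN. Qed.

Lemma additive_map_sum (W W' : zmodType) (f : W -> W') I (r : seq I) (F : I -> W) :
  additive_map f -> f (\sum_(i <- r) F i) = \sum_(i <- r) f (F i).
Proof.
move=> fD; elim/big_rec2: _ => [|i y z _ <-]; first exact: additive_map0.
exact: fD.
Qed.

Section PolyAction.
Context (T : comNzRingType) (W : zmodType) (act : T -> W -> W).
Hypothesis actP : is_action act.

Lemma act0r t : act t 0 = 0.
Proof. by apply: additive_map0 => u v; rewrite (actDr actP). Qed.

Lemma act0l w : act 0 w = 0.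
Proof. by apply: (addIr (act 0 w)); rewrite -(actDl actP) !add0r. Qed.

Lemma actNl t w : act (- t) w = - act t w.
Proof. by apply: (addIr (act t w)); rewrite -(actDl actP) !addNr act0l. Qed.

Lemma actBl s t w : act (s - t) w = act s w - act t w.
Proof. by rewrite (actDl actP) actNl. Qed.

Lemma act_suml I (r : seq I) (F : I -> T) w :
  act (\sum_(i <- r) F i) w = \sum_(i <- r) act (F i) w.
Proof.
by elim/big_rec2: _ => [|i y z _ <-]; rewrite ?act0l ?(actDl actP).
Qed.

Lemma annihilator_ideal w : ideal (fun t => act t w = 0).
Proof.
split=> [|x y xw yw|t x xw]; first exact: act0l.
- by rewrite (actDl actP) xw yw addr0.
- by rewrite (actM actP) xw act0r.
Qed.

(** The [T[X]]-module structure on [W] in which [X] acts as [f]. *)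
Definition poly_ext (f : W -> W) (p : {poly T}) (w : W) :=
  \sum_(i < size p) act p`_i (iter i f w).

Context (f : W -> W).
Hypothesis fD : additive_map f.
Hypothesis fT : forall t, commuting f (act t).

Lemma poly_ext_widen n (p : {poly T}) w : (size p <= n)%N ->
  poly_ext f p w = \sum_(i < n) act p`_i (iter i f w).
Proof.
move=> pn; rewrite /poly_ext (big_ord_widen n (fun i => act p`_i (iter i f w))) //.
rewrite big_mkcond; apply: eq_bigr => i _; case: ltnP => // pi.
by rewrite nth_default // act0l.
Qed.

Lemma poly_extC c w : poly_ext f c%:P w = act c w.
Proof.
rewrite (@poly_ext_widen 1) ?size_polyC ?leq_b1 //.
by rewrite big_ord1 coefC eqxx.
Qed.

Lemma poly_extD p q w : poly_ext f (p + q) w = poly_ext f p w + poly_ext f q w.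
Proof.
rewrite (@poly_ext_widen (maxn (size p) (size q)) (p + q)) ?size_polyD //.
rewrite (@poly_ext_widen (maxn (size p) (size q)) p) ?leq_maxl //.
rewrite (@poly_ext_widen (maxn (size p) (size q)) q) ?leq_maxr //.
rewrite -big_split /=; apply: eq_bigr => i _.
by rewrite coefD (actDl actP).
Qed.

Lemma poly_extMX p w : poly_ext f (p * 'X) w = poly_ext f p (f w).
Proof.
rewrite (@poly_ext_widen (size p).+1); last first.
  by rewrite (leq_trans (size_polyMleq _ _)) // size_polyX addnC.
rewrite big_ord_recl coefMX /= act0l add0r /poly_ext.
by apply: eq_bigr => i _; rewrite coefMX /= -iterS iterSr.
Qed.

Lemma poly_extX w : poly_ext f 'X w = f w.
Proof. by rewrite -[X in poly_ext _ X]mul1r poly_extMX poly_extC (act1 actP). Qed.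

Lemma poly_ext_commute g p : additive_map g -> commuting g f ->
  (forall t, commuting g (act t)) -> commuting g (poly_ext f p).
Proof.
move=> gD gf gT w; rewrite additive_map_sum //; apply: eq_bigr => i _.
by rewrite gT; congr act; elim: (i : nat) => //= j <-; rewrite gf.
Qed.

(** Multiplicativity goes by induction on the left factor, moving [f] past the action of the right
    one; this is where [f] must commute with the scalars. *)
Lemma poly_ext_action : is_action (poly_ext f).
Proof.
have iterD i u v : iter i f (u + v) = iter i f u + iter i f v.
  by elim: i => //= i ->; rewrite fD.
have extDr p : additive_map (poly_ext f p).
  move=> u v; rewrite /poly_ext -big_split; apply: eq_bigr => i _ /=.
  by rewrite iterD (actDr actP).
have ff p : commuting f (poly_ext f p) by apply: poly_ext_commute.
split=> [p u v|p q w|p q w|w]; [exact: extDr|exact: poly_extD| |].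
- elim/poly_ind: p w => [|p c IH] w.
    by rewrite mul0r -polyC0 !poly_extC !act0l.
  rewrite mulrDl mulrAC !poly_extD !poly_extMX IH poly_extC ff; congr (_ + _).
  rewrite (@poly_ext_widen (size q)); last first.
    by rewrite mul_polyC (leq_trans (size_scale_leq _ _)).
  have cD : additive_map (act c) by move=> u v; rewrite (actDr actP).
  rewrite [X in act c X]/poly_ext additive_map_sum //; apply: eq_bigr => i _.
  by rewrite coefCM (actM actP).
- by rewrite -polyC1 poly_extC (act1 actP).
Qed.

End PolyAction.

(** Translates between the value of a polynomial in the ring and the same polynomial in the operator
    by which [t] acts. *)
Lemma act_horner (F T : comNzRingType) (W : zmodType) (act0 : F -> W -> W)
    (act : T -> W -> W) (iota : {rmorphism F -> T}) (q : {poly F}) t w :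
  is_action act -> (forall c, act (iota c) =1 act0 c) ->
  act (map_poly iota q).[t] w = \sum_(i < size q) act0 q`_i (iter i (act t) w).
Proof.
move=> actP actE; rewrite (@horner_coef_wide _ (size q)) ?size_poly //.
rewrite act_suml //; apply: eq_bigr => i _.
rewrite coef_map /= (actM actP) actE; congr act0.
elim: (i : nat) => [|j IH]; first by rewrite expr0 (act1 actP).
by rewrite exprS (actM actP) IH.
Qed.

Fixpoint commuting_family (W : zmodType) (fs : seq (W -> W)) :=
  if fs is f :: fs' then
    [/\ additive_map f, foldr (fun g => and (commuting f g)) True fs' &
        commuting_family fs']
  else True.

(* [T] is an iterated polynomial ring, with one variable for each operator. *)
Lemma commuting_action (F : comNzRingType) (W : zmodType) (act0 : F -> W -> W)
    (fs : seq (W -> W)) :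
  is_action act0 -> commuting_family fs ->
  foldr (fun f => and (forall c, commuting f (act0 c))) True fs ->
  exists (T : comNzRingType) (iota : {rmorphism F -> T}) (act : T -> W -> W)
         (xs : seq T),
    [/\ is_action act, forall c, act (iota c) =1 act0 c, size xs = size fs,
        forall i, (i < size fs)%N -> act xs`_i =1 nth id fs i &
        forall g, additive_map g -> (forall c, commuting g (act0 c)) ->
          foldr (fun f => and (commuting g f)) True fs ->
          forall t, commuting g (act t)].
Proof.
move=> act0P; elim: fs => [_ _|f fs IH /= [fD ffs /IH{}IH] [f0 /IH{IH}]].
  by exists F, idfun, act0, [::]; split=> // g _ g0 _ t; exact: g0.
case=> T [iota [act [xs [actP actE sz xsE comm]]]].
(* [f] commutes with the whole ring built from the later operators, so it can act as a new variable.
   The last conclusion is carried through the induction for this purpose. *)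
have fT := comm f fD f0 ffs.
exists {poly T}, (polyC \o iota), (poly_ext act f), ('X :: map polyC xs); split.
- exact: poly_ext_action.
- by move=> c w /=; rewrite poly_extC // actE.
- by rewrite /= size_map sz.
- case=> [_ w|i ilt w] /=; first by rewrite poly_extX.
  by rewrite (nth_map 0) ?sz // poly_extC // xsE.
- move=> g gD g0 [gf gfs] t; apply: poly_ext_commute => //; exact: comm.
Qed.

End Actions.

(** * Square-free part and Jordan decomposition *)

Lemma root_div_gcd_deriv (F : numFieldType) (p : {poly F}) z :
  p != 0 -> root p z -> root (p %/ gcdp p p^`()) z.
Proof.
move=> p0 pz; set g := gcdp p p^`(); set q := p %/ g.
have qg : q * g = p by rewrite divpK // dvdp_gcdl.
apply/contraT => qz; have [k [r /implyP/(_ p0) rz pE]] := multiplicity_XsubC p z.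
have k0 : (0 < k)%N.
  rewrite lt0n; apply: contraTneq pz => k0.
  by rewrite pE k0 expr0 mulr1.
have cop : coprimep (('X - z%:P) ^+ k) q.
  by rewrite coprimep_expl // coprimep_sym coprimep_XsubC.
have : ('X - z%:P) ^+ k %| p^`().
  apply: dvdp_trans (dvdp_gcdr p _); rewrite -/g -(Gauss_dvdpr _ cop) qg pE.
  exact: dvdp_mulIr.
rewrite pE derivM dvdp_addr; last exact: dvdp_mull.
rewrite deriv_exp derivXsubC mul1r -mulr_natr mulrCA -{1}(prednK k0) exprS mulrC.
rewrite dvdp_mul2l ?expf_neq0 ?polyXsubC_eq0 // dvdp_XsubCl.
by rewrite rootM (negPf rz) rootE -polyC_natr hornerC pnatr_eq0 eqn0Ngt k0.
Qed.

(** [p] is the quotient of [P] by its gcd with its derivative, made monic. Only its roots are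
    complex; the Bezout relation is real and can be mapped into any ring over the reals. *)
Lemma square_free_part (R : realType) (P : {poly R}) : P != 0 ->
  exists (p : {poly R}) (u v : {poly R}) (rs : seq R[i]) (m : nat),
    [/\ u * p + v * p^`() = 1, P %| p ^+ m, uniq rs,
        map_poly (real_complex R) p = \prod_(z <- rs) ('X - z%:P) &
        forall z, z \in rs -> root (map_poly (real_complex R) P) z].
Proof.
move=> P0; pose q := P %/ gcdp P P^`().
have qP : q %| P by apply: divp_dvd; exact: dvdp_gcdl.
have q0 : q != 0 by apply: contraNneq P0 => e; rewrite -dvd0p -e.
have lc0 : lead_coef q != 0 by rewrite lead_coef_eq0.
pose p := (lead_coef q)^-1 *: q.
have pq : p %= q by rewrite eqp_scale // invr_eq0.
have sp : separable_poly p by rewrite (eqp_separable pq) make_separable.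
have pm : p \is monic by rewrite monicE lead_coefZ mulVf.
have pPC : map_poly (real_complex R) p %| map_poly (real_complex R) P.
  by rewrite dvdp_map (eqp_dvdl _ pq).
have [rs rsE] := closed_field_poly_normal (map_poly (real_complex R) p).
rewrite lead_coef_map (monicP pm) rmorph1 scale1r in rsE.
have [rsP rsPE] := closed_field_poly_normal (map_poly (real_complex R) P).
have PC0 : map_poly (real_complex R) P != 0 by rewrite map_poly_eq0.
have /(Bezout_eq1_coprimepP _ _)[[u v] /= uv] : coprimep p p^`().
  by move: sp; rewrite separable_poly.unlock.
(* The exponent counts the roots of [P] with multiplicity: each of its linear factors divides
   [p]. *)
exists p, u, v, rs, (size rsP); split=> //.
- rewrite -(dvdp_map (real_complex R)) rsPE rmorphXn /= dvdpZl ?lead_coef_eq0 //.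
  have rP z : z \in rsP -> root (map_poly (real_complex R) p) z.
    move=> zP; have := @root_div_gcd_deriv _ (map_poly (real_complex R) P) z PC0.
    rewrite deriv_map -gcdp_map -map_divp -/q.
    rewrite {1}rsPE rootZ ?lead_coef_eq0 // root_prod_XsubC => /(_ zP).
    by rewrite /p map_polyZ rootZ // fmorph_eq0 invr_eq0.
  elim: (rsP) rP => [|z s IH] rP; first by rewrite big_nil dvd1p.
  rewrite big_cons exprS dvdp_mul //; first by rewrite dvdp_XsubCl rP // inE eqxx.
  by apply: IH => y ys; apply: rP; rewrite inE ys orbT.
- by rewrite -separable_prod_XsubC -rsE separable_map.
- move=> z zrs; rewrite -dvdp_XsubCl; apply: dvdp_trans pPC.
  by rewrite rsE dvdp_XsubCl root_prod_XsubC.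
Qed.

(** * Annihilating polynomial of the semisimple part and nilpotency bound *)

Section JordanChevalley.
Context (R : realType) (W : lmodType R).
Implicit Types (f s : W -> W) (p P : {poly R}).

Lemma scale_action : is_action ( *:%R : R -> W -> W).
Proof.
split=> *; [exact: scalerDr|exact: scalerDl|by rewrite scalerA|exact: scale1r].
Qed.

Lemma jordan_commuting f s :
  additive_map s -> jordan_semisimple_part f s -> commuting f s.
Proof. by move=> sD [nu [_ _ fE snu]] w; rewrite !fE sD snu. Qed.

Lemma poly_act_invariant p f (U : set W) : subspace U ->
  (forall x, U x -> U (f x)) -> forall x, U x -> U (poly_act p f x).
Proof.
move=> [U0 Ul] Uf x Ux; have UD y z : U y -> U z -> U (y + z).
  by move=> Uy Uz; rewrite -[y]scale1r; exact: Ul.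
apply: big_ind => // i _; rewrite -[_ *: _]addr0; apply: Ul => //.
by elim: (i : nat) => //= j; exact: Uf.
Qed.

(** The kernel of [N] is [f]-invariant, so it has an invariant complement. There [N] is nilpotent
    and injective, which forces the complement to be zero. *)
Lemma semisimple_nilpotent_eq0 f (N : W -> W) : additive_map N ->
  additive_map f ->
  (forall c : R, commuting N ( *:%R c)) -> commuting N f -> semisimple f ->
  (forall U, subspace U -> (forall x, U x -> U (f x)) -> forall x, U x -> U (N x)) ->
  nilpotent N -> forall x, N x = 0.
Proof.
move=> ND fD NZ Nf ssf NU [k Nk].
have [||U' [sU' U'f UU' dec]] := ssf (fun x => N x = 0).
- split; first exact: additive_map0.
  by move=> c x y Nx Ny; rewrite ND NZ Nx Ny scaler0 addr0.
- by move=> x Nx; rewrite Nf Nx additive_map0.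
- have U'0 x : U' x -> x = 0.
    elim: k x {Nk}(Nk x) => [|k IH] x; first by [].
    rewrite iterSr => Nx U'x.
    by apply: UU'; split=> //; apply: (IH (N x)) => //; exact: NU.
  move=> x; have [u [u' [Nu /U'0-> ->]]] := dec x.
  by rewrite addr0.
Qed.

(** Since [f - s] is nilpotent and [P] kills [f], [p] at [s] is nilpotent, hence zero by
    semisimplicity. The nilpotency order supplied by the decomposition may vary with the fiber;
    separability of [p] trades it for [m], which depends only on the polynomials. *)
Lemma jordan_semisimple_part_poly f s P p u v m :
  additive_map f -> additive_map s ->
  (forall c : R, commuting f ( *:%R c)) -> (forall c : R, commuting s ( *:%R c)) ->
  annihilates P f -> jordan_semisimple_part f s ->
  u * p + v * p^`() = 1 -> P %| p ^+ m ->
  annihilates p s /\ forall w, iter m (fun x => f x - s x) w = 0.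
Proof.
move=> fD sD fZ sZ Pf jfs uv Pp; have fs := jordan_commuting sD jfs.
have [nu [ss [k nuk] fE _]] := jfs.
have [||T [iota [act [xs [actP actE _ xsE comm]]]]] :=
  @commuting_action R W *:%R [:: f; s] scale_action.
- by [].
- by [].
pose J t := forall w, act t w = 0.
have iJ : ideal J.
  split=> [w|x y Jx Jy w|t x Jx w]; first exact: act0l.
    by rewrite (actDl actP) Jx Jy addr0.
  by rewrite (actM actP) Jx act0r.
have actf : act xs`_0 = f by apply/funext => w; exact: (xsE 0%N).
have acts : act xs`_1 = s by apply/funext => w; exact: (xsE 1%N).
have hornE q t g w : act t = g -> act (map_poly iota q).[t] w = poly_act q g w.
  by move=> <-; exact: act_horner.
have subX j w : act ((xs`_0 - xs`_1) ^+ j) w = iter j (fun x => f x - s x) w.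
  elim: j => [|j IH]; first by rewrite expr0 (act1 actP).
  by rewrite exprS (actM actP) actBl // actf acts IH.
have iR := ideal_radical iJ.
have Rnu : J ((xs`_0 - xs`_1) ^+ k).
  move=> w; rewrite subX -[RHS](nuk w); congr iter.
  by apply/funext => x; rewrite fE addrC addKr.
have JPf : J (map_poly iota P).[xs`_0] by move=> w; rewrite (hornE _ _ f).
have [q qE] := dvdpP _ _ Pp.
have RPs : radical J (map_poly iota P).[xs`_1].
  have Rd : radical J (xs`_0 - xs`_1) by exists k.
  have := ideal_horner_sub (map_poly iota P) iR Rd.
  by move=> /(idealB iR (sub_radical JPf)); rewrite opprB addrCA subrr addr0.
have /radicalX[K JK] : radical J ((map_poly iota p).[xs`_1] ^+ m).
  by rewrite -horner_exp -rmorphXn /= qE rmorphM hornerM; exact: idealMl.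
have Jps : J (map_poly iota p).[xs`_1].
  apply: (@semisimple_nilpotent_eq0 s) => //.
  - by move=> x y; exact: actDr.
  - move=> c w; rewrite -!actE -!(actM actP); congr act; exact: mulrC.
  - by move=> w; rewrite -acts -!(actM actP) mulrC.
  - move=> U sU Us x Ux; rewrite (hornE _ _ s) //.
    exact: (poly_act_invariant p sU Us Ux).
  - exists K => x; rewrite -[RHS](JK x).
    elim: (K) => [|j IH]; first by rewrite expr0 (act1 actP).
    by rewrite /= IH exprS (actM actP).
split=> w; first by rewrite -(hornE _ _ _ _ acts) Jps.
rewrite -subX; move: w.
apply: (@ideal_separable_uniform _ J (map_poly iota p) (map_poly iota u)
          (map_poly iota v) _ _ _ k) => //.
- by rewrite deriv_map -!rmorphM -rmorphD uv rmorph1.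
- by rewrite -horner_exp -rmorphXn /= qE rmorphM hornerM; exact: (idealMl _ iJ JPf).
Qed.

End JordanChevalley.

(** * Cartan calculus *)

Section CartanCalculus.
Context (R : realType) (n : nat) (M : smoothManifold R n).
Local Notation A := (smooth_fun M).
Local Notation V := (vfield M).
Local Notation Omega := (diff_form M).
Implicit Types (X Y Z : V) (a b : oneform M) (w z : Omega) (h : A) (s t : seq V).

Lemma form_isform w : is_form w.
Proof. by split; [exact: form_multilinear|exact: form_alternating]. Qed.

Lemma formDE w z s : (w + z) s = w s + z s. Proof. by []. Qed.
Lemma formNE w s : (- w) s = - w s. Proof. by []. Qed.
Lemma formZE h w s : (h *: w) s = h * w s. Proof. by []. Qed.
Lemma oneformDE a b X : (a + b) X = a X + b X. Proof. by []. Qed.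
Lemma oneformNE a X : (- a) X = - a X. Proof. by []. Qed.
Lemma oneformZE h a X : (h *: a) X = h * a X. Proof. by []. Qed.
Lemma oneformD a X Y : a (X + Y) = a X + a Y.
Proof. by rewrite -[X in X + Y]scale1r oneform_lin mul1r. Qed.
Lemma oneform0 a : a 0 = 0.
Proof. by apply: (addIr (a 0)); rewrite -oneformD !add0r. Qed.
Lemma oneformZ a h X : a (h *: X) = h * a X.
Proof. by rewrite -[h *: X]addr0 oneform_lin oneform0 addr0. Qed.

Definition form_expand := (formDE, formNE, formZE).

Lemma contraction_cons X w t : w (X :: t) = contraction X w t.
Proof. by []. Qed.

Lemma contractionD X w z : contraction X (w + z) = contraction X w + contraction X z.
Proof. exact: formP. Qed.

Lemma contractionZ X h w : contraction X (h *: w) = h *: contraction X w.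
Proof. exact: formP. Qed.

Lemma contraction_linl h X Y w :
  contraction (h *: X + Y) w = h *: contraction X w + contraction Y w.
Proof. by apply: formP => s /=; exact: (form_lin1 _ _ _ _ (form_multilinear w)). Qed.

Lemma wedge1_linl h a b w : wedge1 (h *: a + b) w = h *: wedge1 a w + wedge1 b w.
Proof.
apply: formP => s; rewrite !form_expand /= /wedge_raw mulr_sumr -big_split /=.
by apply: eq_bigr => i _; ring.
Qed.

Lemma wedge1_linr h a w z : wedge1 a (h *: w + z) = h *: wedge1 a w + wedge1 a z.
Proof. by apply: formP => s; rewrite form_expand; exact: wedge_lin. Qed.

Lemma wedge1D a w z : wedge1 a (w + z) = wedge1 a w + wedge1 a z.
Proof. by have := wedge1_linr 1 a w z; rewrite !scale1r. Qed.

Lemma wedge10 a : wedge1 a 0 = 0.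
Proof. by apply: (addIr (wedge1 a 0)); rewrite -wedge1D !add0r. Qed.

Lemma wedge1Z h a w : wedge1 a (h *: w) = h *: wedge1 a w.
Proof. by rewrite -[h *: w]addr0 wedge1_linr wedge10 addr0. Qed.

Lemma wedge1N a w : wedge1 a (- w) = - wedge1 a w.
Proof. by apply: (addIr (wedge1 a w)); rewrite -wedge1D !addNr wedge10. Qed.

Lemma contraction_wedge X a w :
  contraction X (wedge1 a w) = a X *: w - wedge1 a (contraction X w).
Proof. by apply: formP => s; rewrite !form_expand; exact: wedge_cons. Qed.

Fact dfun_subproof h (k : A) X Y : (k *: X + Y) h = k * X h + Y h.
Proof. by []. Qed.
Definition dfun h := OneForm (dfun_subproof h).

Lemma ext_d_linr h w z :
  ext_d (h *: w + z) = wedge1 (dfun h) w + h *: ext_d w + ext_d z.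
Proof.
by apply: formP => s; rewrite !form_expand; apply: ext_d_lin; exact: form_isform.
Qed.

Lemma ext_dD w z : ext_d (w + z) = ext_d w + ext_d z.
Proof.
have := ext_d_linr 1 w z; rewrite !scale1r => ->.
rewrite -[X in _ = X]add0r -addrA; congr (_ + _); apply: formP => s /=.
rewrite /wedge_raw big1 // => i _.
by rewrite -const_fun1 vfield_const mul0r mulr0.
Qed.

Lemma ext_d_zero : ext_d (0 : Omega) = 0.
Proof. by apply: (addIr (ext_d 0)); rewrite -ext_dD !add0r. Qed.

Lemma ext_dN w : ext_d (- w) = - ext_d w.
Proof. by apply: (addIr (ext_d w)); rewrite -ext_dD !addNr ext_d_zero. Qed.

Lemma ext_dZ h w : ext_d (h *: w) = wedge1 (dfun h) w + h *: ext_d w.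
Proof. by rewrite -[h *: w]addr0 ext_d_linr ext_d_zero addr0. Qed.

(** Induction on the arguments: peeling off the first one is a contraction, which is an
    antiderivation. The same scheme proves [lie_wedge] and [wedge_d_wedge]. *)
Lemma wedge1_anti a b w : wedge1 a (wedge1 b w) = - wedge1 b (wedge1 a w).
Proof.
apply: formP => s; elim: s w => [|X s IH] w.
  by rewrite form_expand /= !wedge_nil oppr0.
rewrite formNE !contraction_cons !contraction_wedge !wedge1D !wedge1N !wedge1Z.
by rewrite !form_expand IH form_expand; ring.
Qed.

(* Locked: otherwise rewriting with [formDE] unfolds it. *)
Fact lie_key : unit. Proof. exact: tt. Qed.
Definition lie := locked_with lie_key
  (fun X w => contraction X (ext_d w) + ext_d (contraction X w)).

Lemma lie_unfold X w : lie X w = contraction X (ext_d w) + ext_d (contraction X w).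
Proof. by rewrite [lie]unlock. Qed.

(** Cartan's formula: it is the recursion [ext_d_cons] rearranged. *)
Lemma lieE X w s : lie X w s = lie_raw w X s.
Proof.
rewrite lie_unfold formDE /= /contract_raw ext_d_cons; last exact: form_isform.
by rewrite subrK.
Qed.

Lemma lieD X w z : lie X (w + z) = lie X w + lie X z.
Proof. by rewrite !lie_unfold ext_dD !contractionD ext_dD addrACA. Qed.

Lemma lieN X w : lie X (- w) = - lie X w.
Proof.
apply: (addIr (lie X w)); rewrite -lieD !addNr.
by apply: (addIr (lie X 0)); rewrite -lieD !add0r.
Qed.

Lemma lieZ X h w : lie X (h *: w) = X h *: w + h *: lie X w.
Proof.
rewrite !lie_unfold ext_dZ contractionD contraction_wedge !contractionZ ext_dZ scalerDr.
by apply: formP => s; rewrite !form_expand /=; ring.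
Qed.

Lemma lie_contraction X Y w :
  lie X (contraction Y w) =
  contraction (bracket X Y) w + contraction Y (lie X w).
Proof.
apply: formP => s; rewrite formDE -![contraction _ _ s]/(_ (_ :: s)).
by rewrite !lieE lie_cons addrC subrK.
Qed.

Lemma lie_wedge X b w :
  lie X (wedge1 b w) = wedge1 (lie_oneform X b) w + wedge1 b (lie X w).
Proof.
apply: formP => s; elim: s w => [|Y s IH] w.
  rewrite !lieE /lie_raw big_ord0 !form_expand /= !wedge_nil.
  by rewrite vfield0 subr0 addr0.
have e : contraction Y (lie X (wedge1 b w)) =
  lie X (contraction Y (wedge1 b w)) - contraction (bracket X Y) (wedge1 b w).
  by rewrite lie_contraction addrC addKr.
rewrite contraction_cons e contraction_wedge lieD lieN lieZ !contraction_wedge.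
rewrite !form_expand IH !contraction_cons !contraction_wedge !form_expand.
rewrite !lie_contraction !wedge1D !form_expand /=; ring.
Qed.

Lemma ext_d1 w Z : ext_d w [:: Z] = Z (w [::]).
Proof.
rewrite /= (ext_d_cons _ _ (form_isform w)) ext_d_nil subr0.
by rewrite /lie_raw big_ord0 subr0.
Qed.

(** Cartan's formula in degree 1. *)
Lemma contract_dE Y a : contract_d Y a = lie_oneform Y a - dfun (a Y).
Proof.
apply: oneformP => Z; rewrite oneformDE oneformNE.
rewrite -[LHS]/(contraction Y (ext_d (form_of_oneform a)) [:: Z]).
rewrite -[contraction _ _](addrK (ext_d (contraction Y (form_of_oneform a)))).
rewrite -lie_unfold formDE formNE ext_d1 lieE /lie_raw /=.
by rewrite big_ord_recl big_ord0 addr0.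
Qed.

(** The anticommutator of [ext_d] with wedging by [a], that is, multiplication by the 2-form [da],
    expressed through [wedge1] and [ext_d] alone. *)
Definition wedge_d := locked_with lie_key
  (fun a w => wedge1 a (ext_d w) + ext_d (wedge1 a w)).

Lemma wedge_d_unfold a w : wedge_d a w = wedge1 a (ext_d w) + ext_d (wedge1 a w).
Proof. by rewrite [wedge_d]unlock. Qed.

Lemma wedge_dD a w z : wedge_d a (w + z) = wedge_d a w + wedge_d a z.
Proof. by rewrite !wedge_d_unfold ext_dD !wedge1D ext_dD addrACA. Qed.

Lemma wedge_dN a w : wedge_d a (- w) = - wedge_d a w.
Proof. by rewrite !wedge_d_unfold ext_dN !wedge1N ext_dN opprD. Qed.

Lemma wedge_dZ a h w : wedge_d a (h *: w) = h *: wedge_d a w.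
Proof.
rewrite !wedge_d_unfold ext_dZ !wedge1D !wedge1Z ext_dZ wedge1_anti scalerDr.
by rewrite addrACA addNr add0r.
Qed.

Lemma contraction_wedge_d Y a w :
  contraction Y (wedge_d a w) =
  wedge_d a (contraction Y w) + wedge1 (contract_d Y a) w.
Proof.
have lE z : contraction Y (ext_d z) = lie Y z - ext_d (contraction Y z).
  by rewrite !lie_unfold addrK.
rewrite contract_dE !wedge_d_unfold contractionD contraction_wedge !lE.
rewrite contraction_wedge.
rewrite lie_wedge !wedge1D wedge1N ext_dD ext_dN ext_dZ.
have -> : wedge1 (lie_oneform Y a - dfun (a Y)) w =
  wedge1 (lie_oneform Y a) w - wedge1 (dfun (a Y)) w.
  by rewrite addrC -scaleN1r wedge1_linl scaleN1r addrC.
by apply: formP => s; rewrite !form_expand; ring.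
Qed.

Lemma wedge_d_wedge a b w : wedge_d a (wedge1 b w) = wedge1 b (wedge_d a w).
Proof.
apply: formP => s; elim: s w => [|Y s IH] w.
  by rewrite wedge_d_unfold form_expand /= !wedge_nil ext_d_nil addr0.
rewrite !contraction_cons contraction_wedge_d !contraction_wedge wedge_dD wedge_dN.
rewrite wedge_dZ contraction_wedge_d wedge1D wedge1_anti !form_expand IH; ring.
Qed.

(** The anticommutator of [X + a] with [d] is the Lie derivative along [X] plus multiplication by
    [da]. Its commutator with [Y + b] gives [[X, Y]] and [L_X b] from the first term, minus the
    contraction of [da] by [Y] from the second. *)
Lemma derived_bracket (x y : gtsection M) w :
  section_op x (ext_d (section_op y w)) + ext_d (section_op x (section_op y w)) -
  section_op y (section_op x (ext_d w) + ext_d (section_op x w)) =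
  section_op (dorfman x y) w.
Proof.
case: x y => [X a] [Y b]; rewrite /section_op /dorfman /=.
have E z : contraction X (ext_d z) + wedge1 a (ext_d z) +
  ext_d (contraction X z + wedge1 a z) = lie X z + wedge_d a z.
  by rewrite lie_unfold wedge_d_unfold ext_dD addrACA.
rewrite !E lieD wedge_dD lie_contraction lie_wedge wedge_d_wedge.
rewrite !contractionD contraction_wedge_d !wedge1D.
have -> : wedge1 (lie_oneform X b - contract_d Y a) w =
  wedge1 (lie_oneform X b) w - wedge1 (contract_d Y a) w.
  by rewrite addrC -scaleN1r wedge1_linl scaleN1r addrC.
by apply: formP => s; rewrite !form_expand; ring.
Qed.

(** The vector part is read off the action on [df] in degree 0, the covector part off the action on
    1 in degree 1. *)
Lemma section_op_inj (x : gtsection M) : (forall w, section_op x w = 0) -> x = 0.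
Proof.
case: x => X a x0; congr (_, _).
  apply: vfieldP => f; have := congr1 (fun w : Omega => w [::])
    (x0 (form_of_oneform (dfun f))).
  by rewrite /section_op !form_expand /= wedge_nil addr0.
apply: oneformP => Z; have := congr1 (fun w : Omega => w [:: Z]) (x0 (form_one M)).
rewrite /section_op formDE [wedge1 _ _ _](contraction_cons Z (wedge1 a _)).
rewrite contraction_wedge formDE formZE formNE /= /contract_raw wedge_nil.
by rewrite mulr1 subr0 add0r.
Qed.

End CartanCalculus.

(** * Derived brackets *)

Section GradedOperators.
Context (R : realType) (n : nat) (M : smoothManifold R n).
Local Notation A := (smooth_fun M).
Local Notation Omega := (diff_form M).
Local Notation G := (gtsection M).
Implicit Types (psi chi D : Omega -> Omega) (x y : G) (w z : Omega).

Definition graded (e : bool) psi := additive_map psi /\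
  forall b w, psi (parity_proj b w) = parity_proj (b (+) e) (psi w).

Lemma parity_projE b w s :
  parity_proj b w s = if odd (size s) == b then w s else 0.
Proof. by []. Qed.

Lemma parity_projD b : additive_map (@parity_proj R n M b).
Proof.
move=> w z; apply: formP => s; rewrite formDE !parity_projE.
by case: ifP; rewrite ?addr0.
Qed.

Lemma parity_projZ b (h : A) w : parity_proj b (h *: w) = h *: parity_proj b w.
Proof.
by apply: formP => s; rewrite formZE !parity_projE formZE; case: ifP; rewrite ?mulr0.
Qed.

Lemma parity_projK b c w :
  parity_proj b (parity_proj c w) = if b == c then parity_proj b w else 0.
Proof.
case: (eqVneq b c) => [<-|bc]; apply: formP => s; rewrite !parity_projE.
  by case: (odd _ == b).
by case: (eqVneq _ b) => // ->; rewrite (negPf bc).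
Qed.

Lemma parity_proj_sum b w : parity_proj b w + parity_proj (~~ b) w = w.
Proof.
apply: formP => s; rewrite formDE !parity_projE.
by case: (odd _) b => -[]; rewrite /= ?addr0 ?add0r.
Qed.

Lemma parity_part_graded e b psi w : graded e psi ->
  parity_part b psi w = if b == e then psi w else 0.
Proof.
move=> [_ pe]; rewrite /parity_part !pe addFb addTb !parity_projK.
case: b e {pe} => -[] /=; rewrite ?addr0 //.
  exact: parity_proj_sum.
exact: (parity_proj_sum false).
Qed.

(** For homogeneous operators only one of the four parity terms survives. *)
Lemma gcommE e e' psi chi w : graded e psi -> graded e' chi ->
  gcomm psi chi w = psi (chi w) - (-1) ^+ (e && e') *: chi (psi w).
Proof.
move=> ge ge'; rewrite /gcomm; congr (_ - _).
have chi0 : chi 0 = 0 by apply: additive_map0; case: ge'.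
rewrite !big_bool /= !(parity_part_graded _ _ ge) !(parity_part_graded _ _ ge').
by case: e e' {ge ge'} => -[] /=; rewrite ?chi0 ?scaler0 ?addr0 ?add0r.
Qed.

Lemma graded_gcomm e e' psi chi : graded e psi -> graded e' chi ->
  graded (e (+) e') (gcomm psi chi).
Proof.
move=> ge ge'; have [pD pe] := ge; have [cD ce] := ge'; split=> [w z|b w].
  rewrite !(gcommE _ ge ge') !cD !pD !cD !scalerDr opprD.
  by rewrite addrACA.
rewrite !(gcommE _ ge ge') !ce !pe !ce.
have -> : b (+) e (+) e' = b (+) e' (+) e by case: b e e' {ge ge' pe ce} => -[] -[].
rewrite -parity_projZ addbA -(additive_mapB _ _ (parity_projD _)); congr parity_proj.
by case: b e e' {ge ge' pe ce} => -[] -[].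
Qed.

Lemma odd_size_delete (T : Type) i (s : seq T) : (i < size s)%N ->
  odd (size (take i s ++ drop i.+1 s)) = ~~ odd (size s).
Proof.
move=> si; rewrite size_cat size_take size_drop si.
by rewrite -[in RHS](subnKC si) addSn /= negbK.
Qed.

Lemma graded_section_op x : graded true (section_op x).
Proof.
case: x => X a; split=> [w z|b w].
  by rewrite /section_op contractionD wedge1D addrACA.
rewrite /section_op /= parity_projD; congr (_ + _); apply: formP => s.
  rewrite parity_projE /= /contract_raw /=.
  by case: (odd _) b => -[].
rewrite parity_projE /= /wedge_raw; case: ifP => sb.
  apply: eq_bigr => i _; rewrite odd_size_delete ?ltn_ord //.
  by move: sb; case: (odd _) b => -[].
rewrite big1 // => i _; rewrite odd_size_delete ?ltn_ord //.
by move: sb; case: (odd _) b => -[] //=; rewrite !mulr0.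
Qed.

Lemma graded_ext_d : graded true (@ext_d R n M).
Proof.
split=> [w z|b w]; first exact: ext_dD.
apply: formP => s; rewrite parity_projE /= /ext_d_raw; case: ifP => sb.
  congr (_ + _); apply: eq_bigr => j _.
    rewrite odd_size_delete ?ltn_ord //.
    by move: sb; case: (odd _) b => -[].
  apply: eq_bigr => i _; rewrite /= odd_size_delete; last first.
    by rewrite /delete size_cat size_take size_drop ltn_ord ltn_addr.
  rewrite odd_size_delete ?ltn_ord //.
  by move: sb; case: (odd _) b => -[].
rewrite !big1 ?addr0 // => j _.
  rewrite big1 // => i _; rewrite /= odd_size_delete; last first.
    by rewrite /delete size_cat size_take size_drop ltn_ord ltn_addr.
  rewrite odd_size_delete ?ltn_ord //.
  by move: sb; case: (odd _) b => -[] //=; rewrite !mulr0.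
rewrite odd_size_delete ?ltn_ord //.
by move: sb; case: (odd _) b => -[] //=; rewrite ?vfield0 ?mulr0.
Qed.

(** Applied to a form of pure parity, the vanishing odd part says that [psi] creates no component of
    the other parity. *)
Lemma graded_even psi : additive_map psi ->
  (forall w, parity_part true psi w = 0) -> graded false psi.
Proof.
move=> pD p0; split=> // b w; rewrite addbF.
have psi0 := additive_map0 pD; have proj0 c := additive_map0 (@parity_projD c).
have p1 c : parity_proj (~~ c) (psi (parity_proj c w)) = 0.
  have := p0 (parity_proj c w); rewrite /parity_part !parity_projK.
  by case: c => /=; rewrite ?psi0 ?proj0 ?addr0 ?add0r.
have e c : psi (parity_proj c w) = parity_proj c (psi (parity_proj c w)).
  by rewrite -[LHS](parity_proj_sum c) p1 addr0.
rewrite -[in RHS](parity_proj_sum b w) pD parity_projD -e.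
by have := p1 (~~ b); rewrite negbK => ->; rewrite addr0.
Qed.

Lemma section_op_linl h x y w :
  section_op (h *: x + y) w = h *: section_op x w + section_op y w.
Proof.
case: x y => X a [Y b]; rewrite /section_op /= contraction_linl wedge1_linl.
by rewrite scalerDr addrACA.
Qed.

Lemma section_opD x y w : section_op (x + y) w = section_op x w + section_op y w.
Proof. by have := section_op_linl 1 x y w; rewrite !scale1r. Qed.

Lemma section_op0l w : section_op (0 : G) w = 0.
Proof. by apply: (addIr (section_op 0 w)); rewrite -section_opD !add0r. Qed.

Lemma section_opN x w : section_op (- x) w = - section_op x w.
Proof.
by apply: (addIr (section_op x w)); rewrite -section_opD !addNr section_op0l.
Qed.

Lemma section_opZ h x w : section_op (h *: x) w = h *: section_op x w.
Proof. by rewrite -[h *: x]addr0 section_op_linl section_op0l addr0. Qed.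

Lemma section_opZr h x w : section_op x (h *: w) = h *: section_op x w.
Proof. by rewrite /section_op contractionZ wedge1Z scalerDr. Qed.

(** [x] and [D] are odd, so the inner bracket is an anticommutator; it is even, so the outer one is
    an ordinary commutator. *)
Lemma derived_bracketE D x y w : graded true D ->
  gcomm (gcomm (section_op x) D) (section_op y) w =
  section_op x (D (section_op y w)) + D (section_op x (section_op y w)) -
  section_op y (section_op x (D w) + D (section_op x w)).
Proof.
move=> gD; have gx := graded_section_op x; have gy := graded_section_op y.
rewrite (gcommE _ (graded_gcomm gx gD) gy) /= expr0 scale1r.
by rewrite !(gcommE _ gx gD) /= expr1 !scaleN1r !opprK.
Qed.

(* The derivation property of [ad p] for the derived bracket of [D]; [x'] and
   [y'] stand for [[p, x]] and [[p, y]]. *)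
Lemma ad_derived_bracket (p D x y x' y' : Omega -> Omega) w :
  additive_map p -> additive_map D -> additive_map x -> additive_map y ->
  (forall u, p (x u) = x (p u) + x' u) -> (forall u, p (y u) = y (p u) + y' u) ->
  let D' u := p (D u) - D (p u) in
  let br (x y D : Omega -> Omega) w :=
    x (D (y w)) + D (x (y w)) - y (x (D w) + D (x w)) in
  br x y D' w = p (br x y D w) - br x y D (p w) - br x' y D w - br x y' D w.
Proof.
move=> pD DD xD yD px py /=.
have pN u := additive_mapN u pD; have DN u := additive_mapN u DD.
have xN u := additive_mapN u xD; have yN u := additive_mapN u yD.
rewrite !(pN, DN, xN, yN, pD, DD, xD, yD, px, py).
by apply: formP => s; rewrite !(formDE, formNE); ring.
Qed.

Section Tilde.
Context (phi : {linear G -> G}) (phit : Omega -> Omega).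
Hypothesis phitP : tilde_of phi phit.

Lemma graded_tilde : graded false phit.
Proof.
case: phitP => lin even _ _ _; apply: graded_even => // w z.
by have := lin 1 w z; rewrite const_fun1 !scale1r.
Qed.

Lemma tilde_section x w :
  phit (section_op x w) = section_op x (phit w) + section_op (phi x) w.
Proof.
have [_ _ _ /(_ x w) <- _] := phitP.
rewrite (gcommE _ graded_tilde (graded_section_op x)) expr0 scale1r.
by rewrite addrC subrK.
Qed.

(** The operator [a - b - c] of the overview. *)
Definition ad_map (B : G -> G -> G) (x y : G) : G :=
  phi (B x y) - B (phi x) y - B x (phi y).

(** A Jacobi identity: bracketing with [phit] is a derivation, and on sections it acts as [phi]. *)
Lemma derived_bracket_ad D (B : G -> G -> G) : graded true D ->
  (forall x y w, gcomm (gcomm (section_op x) D) (section_op y) w =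
     section_op (B x y) w) ->
  forall x y w, gcomm (gcomm (section_op x) (gcomm phit D)) (section_op y) w =
     section_op (ad_map B x y) w.
Proof.
move=> gD DB x y w; have gp := graded_tilde; have gpD := graded_gcomm gp gD.
have xD (z : G) : additive_map (section_op z) by case: (graded_section_op z).
have [DD _] := gD; have [pD _] := gp.
have pDE u : gcomm phit D u = phit (D u) - D (phit u).
  by rewrite (gcommE _ gp gD) expr0 scale1r.
rewrite derived_bracketE // !pDE /ad_map !section_opD !section_opN -!DB.
have -> : section_op (phi (B x y)) w =
  phit (section_op (B x y) w) - section_op (B x y) (phit w).
  by rewrite tilde_section addrC addKr.
rewrite -!DB !derived_bracketE //.
rewrite (@ad_derived_bracket phit D (section_op x) (section_op y)
  (section_op (phi x)) (section_op (phi y))) //; try exact: tilde_section.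
Qed.

Lemma graded_iter_ad i : graded true (iter i (gcomm phit) (@ext_d R n M)).
Proof.
elim: i => [|i IH]; first exact: graded_ext_d.
exact: (graded_gcomm graded_tilde IH).
Qed.

Lemma derived_bracket_iter i x y w :
  gcomm (gcomm (section_op x) (iter i (gcomm phit) (@ext_d R n M)))
    (section_op y) w = section_op (iter i ad_map (@dorfman R n M) x y) w.
Proof.
elim: i x y w => [|i IH] x y w.
  by rewrite derived_bracketE ?derived_bracket //; exact: graded_ext_d.
exact: (derived_bracket_ad (graded_iter_ad i) IH).
Qed.

(** With injectivity of [section_op], this turns minimality into an equation between brackets: [P]
    evaluated at [ad_map] kills the Dorfman bracket. *)
Lemma minimal_torsionE (P : {poly R}) x y w :
  minimal_torsion P phit x y w =
  section_op (\sum_(i < size P)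
    const_fun M P`_i *: iter i ad_map (@dorfman R n M) x y) w.
Proof.
have gP : graded true (poly_ad P phit (@ext_d R n M)).
  rewrite /poly_ad; split=> [u v|b u].
    rewrite -big_split; apply: eq_bigr => i _ /=.
    by have [-> _] := graded_iter_ad i; rewrite scalerDr.
  rewrite (additive_map_sum _ _ (@parity_projD _)); apply: eq_bigr => i _.
  by have [_ ->] := graded_iter_ad i; rewrite parity_projZ.
rewrite /minimal_torsion derived_bracketE // /poly_ad.
have xD (z : G) : additive_map (section_op z) by case: (graded_section_op z).
rewrite (xD y) !(additive_map_sum _ _ (xD _)) -!big_split -sumrB /=.
transitivity (\sum_(i < size P) const_fun M P`_i *:
    section_op (iter i ad_map (@dorfman R n M) x y) w); last first.
  elim/big_rec2: _ => [|i u v _ ->]; first by rewrite section_op0l.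
  by rewrite section_opD section_opZ.
apply: eq_bigr => i _; rewrite -derived_bracket_iter derived_bracketE //; last first.
  exact: graded_iter_ad.
by rewrite !section_opZr -!scalerDr -scalerBr -(xD y).
Qed.

End Tilde.

End GradedOperators.

(** * Eigenvalues, fibers and global sections *)

Section RootsAreEigenvalues.
Context (R : realType) (W : lmodType R) (f : W -> W).
Hypothesis fD : additive_map f.
Hypothesis fZ : forall c : R, commuting f ( *:%R c).

(* Write [P = (X - z) (Q1 + i Q2)] with [Q1], [Q2] real: [Q1(f) w + i Q2(f) w] is
   an eigenvector as soon as it is nonzero, and [Q1], [Q2] are too short to both
   annihilate [f]. *)
Lemma root_minimal_polynomial_eigenvalue (P : {poly R}) z :
  minimal_polynomial f P -> root (map_poly (real_complex R) P) z ->
  complex_eigenvalue f z.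
Proof.
case=> Pm Pf Pmin /factor_theorem[Q QE].
have actP := poly_ext_action (scale_action W) fD fZ.
pose Q1 := map_poly (@complex.Re R) Q; pose Q2 := map_poly (@complex.Im R) Q.
have cQ1 i : Q1`_i = complex.Re Q`_i by rewrite coef_map_id0.
have cQ2 i : Q2`_i = complex.Im Q`_i by rewrite coef_map_id0.
have coefE i : (P`_i)%:C%C = (if i == 0%N then 0 else Q`_i.-1) - Q`_i * z.
  by rewrite -coef_map QE mulrBr coefB coefMX coefMC.
(* [E1] and [E2] are the real and imaginary parts of the factorization [QE]. *)
have E1 : (complex.Im z)%:P * Q2 + ('X - (complex.Re z)%:P) * Q1 = P.
  apply/polyP => i; rewrite coefD coefCM mulrBl coefB coefXM coefCM cQ2 !cQ1.
  have := congr1 (@complex.Re R) (coefE i); case: (i == 0%N) => /=.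
    by case: (Q`_i) z {QE coefE} => q1 q2 [a b] /= ->; ring.
  by case: (Q`_i) (Q`_i.-1) z {QE coefE} => q1 q2 [r1 r2] [a b] /= ->; ring.
have E2 : ('X - (complex.Re z)%:P) * Q2 - (complex.Im z)%:P * Q1 = 0.
  apply/polyP => i; rewrite coef0 coefB coefCM mulrBl coefB coefXM coefCM cQ1 !cQ2.
  have := congr1 (@complex.Im R) (coefE i); case: (i == 0%N) => /=.
    by case: (Q`_i) z {QE coefE E1} => q1 q2 [a b] /=; lra.
  by case: (Q`_i) (Q`_i.-1) z {QE coefE E1} => q1 q2 [r1 r2] [a b] /=; lra.
have [w wn] : exists w, (poly_act Q1 f w, poly_act Q2 f w) <> (0, 0).
  apply: contrapT => h.
  have Q0 w : (poly_act Q1 f w, poly_act Q2 f w) = (0, 0).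
    by apply: contrapT => hw; apply: h; exists w.
  have P0 : P != 0 by exact: monic_neq0.
  have sQ : (size Q < size P)%N.
    rewrite -(size_map_poly (real_complex R)) QE size_Mmonic ?monicXsubC //.
      by rewrite size_XsubC addn2.
    apply: contraNneq P0 => Q0'.
    by rewrite -(map_poly_eq0 (real_complex R)) QE Q0' mul0r.
  have Q1z : Q1 = 0.
    apply/eqP; apply: contraT => /dvdp_leq leq1.
    have /leq1 : P %| Q1 by apply: Pmin => w; case: (Q0 w).
    by rewrite leqNgt (leq_ltn_trans (size_poly _ _) sQ).
  have Q2z : Q2 = 0.
    apply/eqP; apply: contraT => /dvdp_leq leq2.
    have /leq2 : P %| Q2 by apply: Pmin => w; case: (Q0 w).
    by rewrite leqNgt (leq_ltn_trans (size_poly _ _) sQ).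
  by move: P0; rewrite -E1 Q1z Q2z !mulr0 addr0 eqxx.
exists (poly_act Q1 f w), (poly_act Q2 f w); split=> //.
  have := Pf w; rewrite -[poly_act P f w]/(poly_ext *:%R f P w) -{}E1.
  rewrite (actDl actP) !(actM actP) (actBl actP) !(poly_extC (scale_action W)).
  rewrite (poly_extX (scale_action W)) -![poly_ext _ _ _ w]/(poly_act _ f w).
  by rewrite addrCA => /eqP; rewrite addr_eq0 => /eqP ->; rewrite opprD opprK addrC.
have := act0l actP w; rewrite -{}E2.
rewrite (actBl actP) !(actM actP) (actBl actP) !(poly_extC (scale_action W)).
rewrite (poly_extX (scale_action W)) -![poly_ext _ _ _ w]/(poly_act _ f w).
by move/eqP; rewrite subr_eq0 subr_eq => /eqP.
Qed.

End RootsAreEigenvalues.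

(** * Passage between fibers and global sections; symmetry of the roots *)

Section GlobalSections.
Context (R : realType) (n : nat) (M : smoothManifold R n).
Local Notation A := (smooth_fun M).
Local Notation G := (gtsection M).
Implicit Types (f : {linear G -> G}) (x y : G).

Lemma vanishing_at_eval (p : M) x : x \in vanishing_at p ->
  (forall h : A, x.1 h p = 0) /\ (forall X, x.2 X p = 0).
Proof.
move=> /asboolP[r r0 ->]; elim: r r0 => [|q r IH] r0.
  by rewrite big_nil.
have [|IH1 IH2] := IH; first by move=> t tr; apply: r0; rewrite inE tr orbT.
have q0 : q.1 p = 0 by apply: r0; rewrite inE eqxx.
rewrite big_cons; split=> [h|X].
  rewrite -[LHS]/(q.1 p * q.2.1 h p + (\sum_(j <- r) j.1 *: j.2).1 h p).
  by rewrite q0 mul0r add0r IH1.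
rewrite -[LHS]/(q.1 p * q.2.2 X p + (\sum_(j <- r) j.1 *: j.2).2 X p).
by rewrite q0 mul0r add0r IH2.
Qed.

Lemma value0 (p : M) : value p 0 = 0.
Proof. by rewrite -[X in value _ X](subrr 0) valueB subrr. Qed.

(** Evaluation at [p] kills every section that is zero in the fiber at [p]. This promotes identities
    that hold in all fibers to global ones. *)
Lemma section_eq0 x : (forall p : M, value p x = 0) -> x = 0.
Proof.
move=> x0; have xv p : x \in vanishing_at p.
  by have := x0 p; rewrite -(value0 p) => /valueP; rewrite subr0.
case: x {x0} xv => X a xv; congr (_, _).
  apply: vfieldP => h; apply: val_inj; apply/funext => p.
  by case: (vanishing_at_eval (xv p)) => /(_ h).
apply: oneformP => Y; apply: val_inj; apply/funext => p.
by case: (vanishing_at_eval (xv p)) => _ /(_ Y).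
Qed.

Lemma fiber_scaleE (p : M) (c : R) x : c *: value p x = value p (const_fun M c *: x).
Proof. exact: valueZ. Qed.

Lemma fiber_ind (p : M) (Q : fiber p -> Prop) :
  (forall x, Q (value p x)) -> forall u, Q u.
Proof. by move=> Qx u; rewrite -(representativeK u). Qed.

Lemma fiber_mapD (p : M) f : additive_map (@fiber_map _ _ _ p f).
Proof.
move=> u v; rewrite -(representativeK u) -(representativeK v) -valueD !fiber_mapE.
by rewrite raddfD valueD.
Qed.

Lemma fiber_mapZ (p : M) f (c : R) : commuting (@fiber_map _ _ _ p f) ( *:%R c).
Proof.
move=> u; rewrite -(representativeK u) fiber_scaleE !fiber_mapE linearZ.
by rewrite fiber_scaleE.
Qed.

Definition const_scale (c : R) x : G := const_fun M c *: x.

Lemma const_scale_action : is_action const_scale.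
Proof.
rewrite /const_scale; split=> *.
- exact: scalerDr.
- by rewrite const_funD scalerDl.
- by rewrite const_funM scalerA.
- by rewrite const_fun1 scale1r.
Qed.

Lemma linear_const_scale f c : commuting f (const_scale c).
Proof. by move=> x; rewrite /const_scale linearZ. Qed.

Lemma linear_additive f : additive_map f.
Proof. by move=> x y; rewrite raddfD. Qed.

Lemma poly_act_value (p : M) (Q : {poly R}) f x :
  poly_act Q (@fiber_map _ _ _ p f) (value p x) = value p (poly_ext const_scale f Q x).
Proof.
rewrite /poly_ext (additive_map_sum _ _ (@valueD _ _ _ p)) /poly_act.
apply: eq_bigr => i _; rewrite -fiber_scaleE; congr (_ *: _).
by elim: (i : nat) => //= j ->; rewrite fiber_mapE.
Qed.

Lemma annihilates_fibers (Q : {poly R}) f :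
  (forall p, annihilates Q (@fiber_map _ _ _ p f)) <->
  (forall x, poly_ext const_scale f Q x = 0).
Proof.
split=> [Qf x|Qf p]; first by apply: section_eq0 => p; rewrite -poly_act_value Qf.
by elim/fiber_ind => x; rewrite poly_act_value Qf value0.
Qed.

Lemma pairingD x y z : pairing x (y + z) = pairing x y + pairing x z.
Proof.
rewrite /pairing -mulrDr; congr (_ * _).
by rewrite -[(y + z).1]/(y.1 + z.1) oneformD -[(y + z).2]/(y.2 + z.2) oneformDE addrACA.
Qed.

Lemma pairingZ x (h : A) y : pairing x (h *: y) = h * pairing x y.
Proof.
rewrite /pairing -[(h *: y).1]/(h *: y.1) oneformZ -[(h *: y).2]/(h *: y.2) oneformZE.
by rewrite -mulrDr mulrCA.
Qed.

Lemma pairingC x y : pairing x y = pairing y x.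
Proof. by rewrite /pairing addrC. Qed.

(** Exact one-forms detect the vector part, vector fields the covector part. *)
Lemma pairing_nondegenerate x : (forall y, pairing y x = 0) -> x = 0.
Proof.
move=> x0; have {}x0 y : y.2 x.1 + x.2 y.1 = 0.
  have := congr1 (fun h => const_fun M 2 * h) (x0 y).
  by rewrite /pairing mulrA -const_funM divff ?pnatr_eq0 // const_fun1 mul1r mulr0.
case: x x0 => X a x0; congr (_, _).
  by apply: vfieldP => h; have := x0 (0, dfun h); rewrite /= oneform0 addr0.
by apply: oneformP => Y; have := x0 (Y, 0); rewrite /= add0r.
Qed.

(** Each factor ['X] crosses the pairing with a sign. *)
Lemma skew_symmetric_poly f (Q : {poly R}) x y : skew_symmetric f ->
  pairing (poly_ext const_scale f Q x) y =
  pairing x (poly_ext const_scale f (Q \Po (- 'X)) y).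
Proof.
move=> skew; have cP := const_scale_action.
have actP := poly_ext_action cP (@linear_additive f) (linear_const_scale f).
have pairingDl (u v z : G) : pairing (u + v) z = pairing u z + pairing v z.
  by rewrite pairingC pairingD !(pairingC z).
have pairingZl h (u z : G) : pairing (h *: u) z = h * pairing u z.
  by rewrite pairingC pairingZ (pairingC z).
have pairingNr (u z : G) : pairing u (- z) = - pairing u z.
  by rewrite -scaleN1r pairingZ mulN1r.
elim/poly_ind: Q x y => [|Q c IH] x y.
  rewrite comp_poly0 !(act0l actP).
  by rewrite -[X in pairing X y](scale0r x) -[X in pairing x X](scale0r y)
    pairingZl pairingZ !mul0r.
rewrite comp_poly_MXaddC !(actDl actP) pairingDl pairingD !(poly_extC cP).
rewrite /const_scale pairingZl pairingZ; congr (_ + _).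
rewrite poly_extMX // IH skew mulrC mulNr (actNl actP) pairingNr (actM actP).
by rewrite (poly_extX cP).
Qed.

(** By skewness and nondegeneracy [P \Po (- 'X)] also annihilates [f], so the minimal polynomial [P]
    divides it. The pairing lives on global sections, whence the detour through them. *)
Lemma root_minimal_polynomial_opp f (P : {poly R}) (p0 : M) z :
  skew_symmetric f -> (forall p, minimal_polynomial (@fiber_map _ _ _ p f) P) ->
  root (map_poly (real_complex R) P) z -> root (map_poly (real_complex R) P) (- z).
Proof.
move=> skew minP Pz; have PG : forall x, poly_ext const_scale f P x = 0.
  by apply/annihilates_fibers => p; case: (minP p).
have /annihilates_fibers/(_ p0) : forall x, poly_ext const_scale f (P \Po (- 'X)) x = 0.
  move=> x; apply: pairing_nondegenerate => y.
  by rewrite -skew_symmetric_poly // PG -(scale0r y) pairingC pairingZ mul0r.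
have [_ _ Pmin] := minP p0; move/Pmin; rewrite -(dvdp_map (real_complex R)).
rewrite map_comp_poly rmorphN /= map_polyX => dP.
have := dvdp_trans (_ : 'X - z%:P %| map_poly (real_complex R) P) dP.
rewrite !dvdp_XsubCl => /(_ Pz).
by rewrite /root horner_comp hornerN hornerX.
Qed.

End GlobalSections.

(** * Operators on the space of brackets *)

Section DorfmanLinear.
Context (R : realType) (n : nat) (M : smoothManifold R n).
Local Notation A := (smooth_fun M).
Local Notation Omega := (diff_form M).
Local Notation G := (gtsection M).
Implicit Types (x y : G).

Lemma ext_d_const (c : R) (w z : Omega) :
  ext_d (const_fun M c *: w + z) = const_fun M c *: ext_d w + ext_d z.
Proof.
rewrite ext_dD ext_dZ; congr (_ + _).
rewrite -[RHS]add0r; congr (_ + _); apply: formP => s /=.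
by rewrite /wedge_raw big1 // => i _; rewrite /= vfield_const mul0r mulr0.
Qed.

Lemma derived_bracket_linl (c : R) (d x x' y xx : Omega -> Omega) w :
  (forall u v, d (const_fun M c *: u + v) = const_fun M c *: d u + d v) ->
  (forall u v, y (const_fun M c *: u + v) = const_fun M c *: y u + y v) ->
  additive_map d -> additive_map y ->
  (forall u, xx u = const_fun M c *: x u + x' u) ->
  let br (x y : Omega -> Omega) := x (d (y w)) + d (x (y w)) - y (x (d w) + d (x w)) in
  br xx y = const_fun M c *: br x y + br x' y.
Proof.
move=> dl yl dD yD xxE /=; rewrite !xxE !dl yD !yl !yD.
by apply: formP => s; rewrite !(formDE, formNE, formZE); ring.
Qed.

Lemma derived_bracket_linr (c : R) (d x y y' yy : Omega -> Omega) w :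
  (forall u v, d (const_fun M c *: u + v) = const_fun M c *: d u + d v) ->
  (forall u v, x (const_fun M c *: u + v) = const_fun M c *: x u + x v) ->
  (forall u, yy u = const_fun M c *: y u + y' u) ->
  let br (x y : Omega -> Omega) := x (d (y w)) + d (x (y w)) - y (x (d w) + d (x w)) in
  br x yy = const_fun M c *: br x y + br x y'.
Proof.
move=> dl xl yyE /=; rewrite !yyE !(dl, xl).
by apply: formP => s; rewrite !(formDE, formNE, formZE); ring.
Qed.

Lemma section_op_ext x y : (forall w, section_op x w = section_op y w) -> x = y.
Proof.
move=> xy; apply/eqP; rewrite -subr_eq0; apply/eqP; apply: section_op_inj => w.
by rewrite section_opD section_opN xy subrr.
Qed.

Lemma section_op_linr (h : A) x (w z : Omega) :
  section_op x (h *: w + z) = h *: section_op x w + section_op x z.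
Proof.
by have [-> _] := graded_section_op x; rewrite section_opZr.
Qed.

(** Read off the derived bracket by injectivity of [section_op]. The scalars are constants because
    [ext_d] is linear only over these. *)
Lemma dorfman_linl (c : R) x x' y :
  dorfman (const_fun M c *: x + x') y = const_fun M c *: dorfman x y + dorfman x' y.
Proof.
apply: section_op_ext => w; rewrite section_op_linl -!derived_bracket.
apply: (derived_bracket_linl (xx := section_op _)).
- exact: ext_d_const.
- by move=> u v; exact: section_op_linr.
- exact: ext_dD.
- by case: (graded_section_op y).
- by move=> u; exact: section_op_linl.
Qed.

Lemma dorfman_linr (c : R) x y y' :
  dorfman x (const_fun M c *: y + y') = const_fun M c *: dorfman x y + dorfman x y'.
Proof.
apply: section_op_ext => w; rewrite section_op_linl -!derived_bracket.
apply: (derived_bracket_linr (yy := section_op _)).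
- exact: ext_d_const.
- by move=> u v; exact: section_op_linr.
- by move=> u; exact: section_op_linl.
Qed.

End DorfmanLinear.

(** * The complexified space of brackets and its operators *)

Section BracketSpace.
Context (R : realType) (n : nat) (M : smoothManifold R n).
Local Notation G := (gtsection M).
Local Notation V := (G -> G -> G).
Local Notation C := R[i].
Implicit Types (B : V) (x y : G) (f g : {linear G -> G}) (T U : V -> V).

Definition real_scale (r : R) B : V := fun x y => const_scale r (B x y).

(** [V * V] is the complexification of [V], needed because the roots of [P] are complex scalars. *)
Definition complex_scale (z : C) (w : V * V) : V * V :=
  (real_scale (complex.Re z) w.1 - real_scale (complex.Im z) w.2,
   real_scale (complex.Im z) w.1 + real_scale (complex.Re z) w.2).

Lemma complex_scale_action : is_action complex_scale.
Proof.
have cP := const_scale_action M.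
have addE (B B' : V) x y : (B + B') x y = B x y + B' x y by [].
have oppE (B : V) x y : (- B) x y = - B x y by [].
have eqV (w z : V * V) : (forall x y, w.1 x y = z.1 x y) ->
    (forall x y, w.2 x y = z.2 x y) -> w = z.
  case: w z => [w1 w2] [z1 z2] /= e1 e2; congr (_, _); apply/funext => x;
  by apply/funext => y.
have scNr c x : const_scale c (- x) = - const_scale c x.
  by rewrite /const_scale scalerN.
split=> [[a b] [B1 B2] [B1' B2']|[a b] [a' b'] [B1 B2]|[a b] [a' b'] [B1 B2]|[B1 B2]].
- apply: eqV => x y /=; rewrite !(addE, oppE) /real_scale !(actDr cP) ?opprD.
    by rewrite addrACA.
  by rewrite addrACA.
- apply: eqV => x y /=; rewrite !(addE, oppE) /real_scale !(actDl cP) ?opprD.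
    by rewrite addrACA.
  by rewrite addrACA.
- apply: eqV => x y /=; rewrite !(addE, oppE) /real_scale.
    rewrite !(actDr cP) !(actBl cP) !(actDl cP) !scNr !(actM cP) !opprD.
    by rewrite !addrA; congr (_ + _); rewrite addrAC.
  rewrite !(actDr cP) !(actBl cP) !(actDl cP) !scNr !(actM cP).
  by rewrite [RHS]addrACA; congr (_ + _); rewrite addrC.
- apply: eqV => x y /=; rewrite !(addE, oppE) /real_scale.
    by rewrite (act0l cP) subr0 (act1 cP).
  by rewrite (act0l cP) add0r (act1 cP).
Qed.

Definition on_pair T (w : V * V) : V * V := (T w.1, T w.2).

(** With [f] equal to [phi] or [psi], these are the six operators of the overview. As brackets range
    over arbitrary maps, both precompositions are additive by definition, and operators of different
    kinds commute once the postcomposed map is arbitrary. *)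
Definition postcomp (f : G -> G) B : V := fun x y => f (B x y).
Definition precomp1 (f : G -> G) B : V := fun x y => B (f x) y.
Definition precomp2 (f : G -> G) B : V := fun x y => B x (f y).

Lemma on_pair_additive T : additive_map T -> additive_map (on_pair T).
Proof. by move=> TD [B1 B2] [B1' B2']; rewrite /on_pair /= !TD. Qed.

Lemma on_pair_commuting T U : commuting T U -> commuting (on_pair T) (on_pair U).
Proof. by move=> TU [B1 B2]; rewrite /on_pair /= !TU. Qed.

Lemma on_pair_scale T z : additive_map T ->
  (forall r, commuting T (real_scale r)) -> commuting (on_pair T) (complex_scale z).
Proof.
move=> TD TZ [B1 B2]; rewrite /on_pair /complex_scale /=.
by rewrite (additive_mapB _ _ TD) TD !TZ.
Qed.

Lemma postcomp_additive f : additive_map (postcomp f).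
Proof.
by move=> B B'; apply/funext => x; apply/funext => y; rewrite /postcomp raddfD.
Qed.

Lemma postcomp_scale f r : commuting (postcomp f) (real_scale r).
Proof.
move=> B; apply/funext => x; apply/funext => y.
by rewrite /postcomp /real_scale linear_const_scale.
Qed.

Lemma postcomp_commuting f g : commuting f g -> commuting (postcomp f) (postcomp g).
Proof.
by move=> fg B; apply/funext => x; apply/funext => y; rewrite /postcomp fg.
Qed.

Lemma precomp1_commuting f g : commuting f g -> commuting (precomp1 f) (precomp1 g).
Proof.
by move=> fg B; apply/funext => x; apply/funext => y; rewrite /precomp1 fg.
Qed.

Lemma precomp2_commuting f g : commuting f g -> commuting (precomp2 f) (precomp2 g).
Proof.
by move=> fg B; apply/funext => x; apply/funext => y; rewrite /precomp2 fg.
Qed.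

Lemma iter_on_pair T i B : T 0 = 0 -> iter i (on_pair T) (B, 0) = (iter i T B, 0).
Proof. by move=> T0; elim: i => //= i ->; rewrite /on_pair /= T0. Qed.

(** A real polynomial in a real operator keeps the imaginary part of [(B, 0)] zero, so an identity
    between real brackets suffices. *)
Lemma bracket_action_horner (K : comNzRingType) (iota : {rmorphism C -> K})
    (act : K -> V * V -> V * V) t T (q : {poly R}) B :
  is_action act -> (forall c, act (iota c) =1 complex_scale c) ->
  act t =1 on_pair T -> T 0 = 0 ->
  (forall x y, \sum_(i < size q) const_scale q`_i (iter i T B x y) = 0) ->
  act (map_poly iota (map_poly (real_complex R) q)).[t] (B, 0) = 0.
Proof.
move=> actP actE /funext tE T0 q0; rewrite (act_horner _ _ _ actP actE) tE.
rewrite size_map_poly.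
transitivity ((\sum_(i < size q) real_scale q`_i (iter i T B), 0) : V * V).
  have cE i :
      complex_scale (map_poly (real_complex R) q)`_i (iter i (on_pair T) (B, 0)) =
      (real_scale q`_i (iter i T B), 0).
    rewrite coef_map iter_on_pair // /complex_scale /=.
    have s0 r : real_scale r 0 = 0.
      by apply/funext => x; apply/funext => y; rewrite /real_scale /const_scale scaler0.
    have s0' B' : real_scale 0 B' = 0.
      by apply/funext => x; apply/funext => y; exact: (act0l (const_scale_action M)).
    by rewrite !s0 s0' subr0 addr0.
  by elim/big_rec2: _ => [|i u v _ ->] //; rewrite cE; congr (_, _); rewrite addr0.
congr (_, _); apply/funext => x; apply/funext => y; rewrite -[RHS](q0 x y).
by elim/big_rec2: _ => // i u v _ <-.
Qed.

Lemma bracket_action_exp (K : comNzRingType) (act : K -> V * V -> V * V) t T B m :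
  is_action act -> act t =1 on_pair T -> T 0 = 0 ->
  act (t ^+ m) (B, 0) = (iter m T B, 0).
Proof.
move=> actP tE T0; elim: m => [|m IH]; first by rewrite expr0 (act1 actP).
by rewrite exprS (actM actP) IH tE /on_pair /= T0.
Qed.

End BracketSpace.

(** * From the ideal-theoretic statement to the shifted torsion *)

Section Assembly.
Context (R : realType) (n : nat) (M : smoothManifold R n).
Local Notation G := (gtsection M).
Local Notation V := (G -> G -> G).
Local Notation C := R[i].
Context (phi psi : {linear G -> G}).
Hypothesis phi_psi : commuting phi psi.
Local Notation D := (@dorfman R n M).

Let dorfmanDl y : additive_map (fun x => D x y).
Proof. by move=> u v; have := dorfman_linl 1 u v y; rewrite const_fun1 !scale1r. Qed.

Let dorfmanDr x : additive_map (D x).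
Proof. by move=> u v; have := dorfman_linr 1 x u v; rewrite const_fun1 !scale1r. Qed.

Lemma dorfman_suml (I : Type) (r : seq I) (c : I -> R) (u : I -> G) y :
  \sum_(i <- r) const_scale (c i) (D (u i) y) =
  D (\sum_(i <- r) const_scale (c i) (u i)) y.
Proof.
have D0 := additive_map0 (@dorfmanDl y).
by elim/big_rec2: _ => [|i v w _ ->]; rewrite ?D0 // dorfman_linl.
Qed.

Lemma dorfman_sumr (I : Type) (r : seq I) (c : I -> R) (u : I -> G) x :
  \sum_(i <- r) const_scale (c i) (D x (u i)) =
  D x (\sum_(i <- r) const_scale (c i) (u i)).
Proof.
have D0 := additive_map0 (@dorfmanDr x).
by elim/big_rec2: _ => [|i v w _ ->]; rewrite ?D0 // dorfman_linr.
Qed.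

Lemma shifted_torsion_vanishes (P p : {poly R}) (rs : seq C) m :
  uniq rs -> map_poly (real_complex R) p = \prod_(z <- rs) ('X - z%:P) ->
  (forall x, poly_ext (@const_scale R n M) psi p x = 0) ->
  (forall x, iter m (fun x => phi x - psi x) x = 0) ->
  (forall x y, \sum_(i < size P) const_scale P`_i (iter i (ad_map phi) D x y) = 0) ->
  (forall la mu nu, la \in rs -> mu \in rs -> nu \in rs ->
     (mu + nu) * (la - mu) * (la - nu) != 0 ->
     (map_poly (real_complex R) P).[la - mu - nu] != 0) ->
  weak_generalized_nijenhuis psi.
Proof.
move=> urs pE psi0 nil min nonres.
have psi_phi : commuting psi phi by move=> x; rewrite phi_psi.
pose ops := map (@on_pair R n M)
  [:: postcomp phi; precomp1 phi; precomp2 phi;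
      postcomp psi; precomp1 psi; precomp2 psi].
have aD := @postcomp_additive R n M; have aC := @on_pair_commuting R n M.
have aL (T : V -> V) : additive_map T -> additive_map (on_pair T).
  exact: on_pair_additive.
have [||K [iota [act [xs [actP actE _ xsE _]]]]] :=
  @commuting_action C (V * V)%type (@complex_scale R n M) ops
    (@complex_scale_action R n M).
- rewrite /ops /=; repeat split; try by [apply: aL | apply: aC].
  + by apply: aC; apply: postcomp_commuting.
  + by apply: aC; apply: precomp1_commuting.
  + by apply: aC; apply: precomp2_commuting.
- rewrite /ops /=; repeat split; move=> c; apply: (@on_pair_scale R n M) => //;
  by move=> r; exact: postcomp_scale.
have e0 := xsE 0%N isT; have e1 := xsE 1%N isT; have e2 := xsE 2%N isT.
have e3 := xsE 3%N isT; have e4 := xsE 4%N isT; have e5 := xsE 5%N isT.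
rewrite /ops /= in e0 e1 e2 e3 e4 e5.
(* [E] is the operator [C] of the overview, a letter taken here by the complex numbers. *)
set a := xs`_0 in e0; set b := xs`_1 in e1; set c := xs`_2 in e2.
set A := xs`_3 in e3; set B := xs`_4 in e4; set E := xs`_5 in e5.
pose J t := act t (D, 0) = 0.
have iJ : ideal J by exact: annihilator_ideal.
have prodE t : \prod_(z <- rs) (t - iota z) =
    (map_poly iota (map_poly (real_complex R) p)).[t].
  rewrite pE rmorph_prod horner_prod; apply: eq_bigr => z _.
  by rewrite /= map_polyXsubC hornerXsubC.
have pairB T U t u : act t =1 on_pair T -> act u =1 on_pair U ->
    act (t - u) =1 on_pair (fun B => T B - U B).
  by move=> tT uU w; rewrite actBl // tT uU.
have post0 f : postcomp (f : {linear G -> G}) 0 = 0 by exact: additive_map0.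
have pre10 f : precomp1 f 0 = 0 :> V by [].
have pre20 f : precomp2 f 0 = 0 :> V by [].
have iter_post f i B' x y : iter i (postcomp f) B' x y = iter i f (B' x y) :> G.
  by elim: i => //= i IH; rewrite /postcomp IH.
have iter_pre1 f i B' x y : iter i (precomp1 f) B' x y = B' (iter i f x) y :> G.
  by elim: i x => //= i IH x; rewrite /precomp1 IH -iterS iterSr.
have iter_pre2 f i B' x y : iter i (precomp2 f) B' x y = B' x (iter i f y) :> G.
  by elim: i y => //= i IH y; rewrite /precomp2 IH -iterS iterSr.
have fx0 (T U : V -> V) : T 0 = 0 -> U 0 = 0 -> T (0 : V) - U 0 = 0 :> V.
  by move=> -> ->; rewrite subr0.
pose nu x := phi x - psi x.
have nuB j (u v : G) : iter j nu (u - v) = iter j nu u - iter j nu v.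
  have nuD : additive_map nu.
    move=> {}u {}v; rewrite /nu (@linear_additive _ _ _ phi).
    by rewrite (@linear_additive _ _ _ psi) opprD addrACA.
  by apply: additive_mapB => {}u {}v; elim: j => //= j ->; rewrite nuD.
have horner0 t T (q : {poly R}) : act t =1 on_pair T -> T 0 = 0 ->
    (forall x y, \sum_(i < size q) const_scale q`_i (iter i T D x y) = 0) ->
    J (map_poly iota (map_poly (real_complex R) q)).[t].
  by move=> tT T0 q0; exact: (bracket_action_horner actP actE tT T0 q0).
have exp0 t T : act t =1 on_pair T -> T 0 = 0 ->
    (forall x y, iter m T D x y = 0) -> J (t ^+ m).
  move=> tT T0 Tm; rewrite /J (bracket_action_exp _ _ actP tT T0); congr (_, _).
  by apply/funext => x; apply/funext => y; exact: Tm.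
have : J ((B + E) * (A - B) * (A - E)).
  apply: (non_resonant_ideal (rs := rs) (P := map_poly (real_complex R) P)
    (a := a) (b := b) (c := c) (k := m) (iota := iota)) => //; rewrite ?prodE.
  - apply: (horner0 _ _ _ e3) => // x y; rewrite -[RHS](psi0 (D x y)).
    by apply: eq_bigr => i _; rewrite iter_post.
  - apply: (horner0 _ _ _ e4) => // x y; under eq_bigr do rewrite iter_pre1.
    by rewrite dorfman_suml [X in D X](psi0 x); exact: (additive_map0 (@dorfmanDl y)).
  - apply: (horner0 _ _ _ e5) => // x y; under eq_bigr do rewrite iter_pre2.
    by rewrite dorfman_sumr [X in D _ X](psi0 y); exact: (additive_map0 (@dorfmanDr x)).
  - apply: (exp0 _ _ (pairB _ _ _ _ e0 e3)) => [|x y]; first exact: fx0.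
    rewrite -[RHS](nil (D x y)).
    by elim: (m) => //= j IH; rewrite /postcomp -IH.
  - apply: (exp0 _ _ (pairB _ _ _ _ e1 e4)) => [|x y]; first exact: fx0.
    (* Additivity of the Dorfman bracket in its first argument turns powers of [b - B] into
       precomposition with iterates of [nu]. *)
    transitivity (D (iter m nu x) y).
      elim: (m) x => //= j IH x.
      rewrite -[LHS]/(iter j _ D (phi x) y - iter j _ D (psi x) y) !IH.
      by rewrite -iterS iterSr nuB (additive_mapB _ _ (@dorfmanDl y)).
    by rewrite [iter m nu x]nil; exact: additive_map0 (@dorfmanDl y).
  - apply: (exp0 _ _ (pairB _ _ _ _ e2 e5)) => [|x y]; first exact: fx0.
    transitivity (D x (iter m nu y)).
      elim: (m) y => //= j IH y.
      rewrite -[LHS]/(iter j _ D x (phi y) - iter j _ D x (psi y)) !IH.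
      by rewrite -iterS iterSr nuB (additive_mapB _ _ (@dorfmanDr x)).
    by rewrite [iter m nu y]nil; exact: additive_map0 (@dorfmanDr x).
  - have tE : act (a - b - c) =1 on_pair (@ad_map R n M phi).
      by move=> w; rewrite (pairB _ _ _ _ (pairB _ _ _ _ e0 e1) e2).
    apply: (horner0 _ _ _ tE _ min).
    by apply/funext => x; apply/funext => y; rewrite /ad_map raddf0 !subr0.
(* [(A - B) * (A - E)] turns the Dorfman bracket into [torsion psi]; [B + E] then inserts [psi] in
   either argument. *)
rewrite /J -mulrA !(actM actP) (pairB _ _ _ _ e3 e5) (pairB _ _ _ _ e3 e4).
rewrite (actDl actP) e4 e5 => /(congr1 fst) /= T0 x y.
have /= {T0} := congr1 (fun U : V => U x y) T0.
have psiD := @linear_additive R n M psi.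
have psiB u v : psi (u - v) = psi u - psi v by exact: (additive_mapB _ _ psiD).
rewrite -[(_ + _) x y]/(_ x y + _ x y) => T0; rewrite /shifted_torsion -[RHS]T0.
have Texp (u v : G) : torsion psi u v =
  psi (psi (D u v) - D u (psi v)) - (psi (D (psi u) v) - D (psi u) (psi v)).
  by rewrite /torsion psiB psiD opprB opprD [RHS]addrACA [- _ - _]addrC.
by rewrite !Texp.
Qed.

End Assembly.

Theorem theorem125 (R : realType) (n : nat) (M : smoothManifold R n)
    (phi phi_s : {linear gtsection M -> gtsection M}) (P : {poly R}) :
  generalized_polynomial_structure phi P ->
  non_resonant phi P ->
  minimal phi P ->
  semisimple_part phi phi_s ->
  weak_generalized_nijenhuis phi_s.
Proof.
move=> [skew Pm _ minP] nonres [phit phitP tor0] jord.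
(* A point is used to realize the roots of [P] as eigenvalues; over the empty manifold every section
   is zero. *)
have [[p0 _]|noM] := pselect (exists p : M, True); last first.
  by move=> x y; apply: section_eq0 => p; case: noM; exists p.
(* [p] and [m] come from [P] alone, so they serve all fibers at once. *)
have [p [u [v [rs [m [uv Pp urs pE rsP]]]]]] := square_free_part (monic_neq0 Pm).
have fib q : annihilates p (@fiber_map _ _ _ q phi_s) /\ forall w,
    iter m (fun x => @fiber_map _ _ _ q phi x - @fiber_map _ _ _ q phi_s x) w = 0.
  apply: jordan_semisimple_part_poly uv Pp => //.
  1,2: exact: fiber_mapD.
  1,2: exact: fiber_mapZ.
  by case: (minP q).
have rootS z : root (map_poly (real_complex R) P) z -> Sigma phi z.
  move=> Pz; exists p0; apply: root_minimal_polynomial_eigenvalue (minP p0) Pz.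
    exact: fiber_mapD.
  exact: fiber_mapZ.
have rootN := root_minimal_polynomial_opp p0 skew minP.
apply: (@shifted_torsion_vanishes R n M phi phi_s _ P p rs m) => //.
- move=> x; apply/eqP; rewrite -subr_eq0; apply/eqP; apply: section_eq0 => q.
  rewrite valueB -!fiber_mapE.
  by rewrite (jordan_commuting (@fiber_mapD _ _ _ _ _) (jord q)) subrr.
- by apply/annihilates_fibers => q; case: (fib q).
- move=> x; apply: section_eq0 => q; have [_ /(_ (value q x)) <-] := fib q.
  by elim: (m) => //= j <-; rewrite valueB !fiber_mapE.
- move=> x y; apply: section_op_inj => w.
  by rewrite -[RHS](tor0 x y w) (minimal_torsionE phitP).
(* Non-resonance is applied to [la], [- mu], [- nu], eigenvalues by the symmetry of the roots; the
   two products of three factors then differ by a sign. *)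
- move=> la mu nu /rsP Pla /rsP Pmu /rsP Pnu ne0.
  apply: nonres; [exact: rootS|exact: rootS (rootN _ Pmu)|exact: rootS (rootN _ Pnu)|].
  rewrite -opprD mulrN oppr_eq0.
  by apply: contra_neq ne0 => e; rewrite -e; ring.
Qed.
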